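(* Let $\varphi=(1+\sqrt5)/2$ and let $T$ be the real root of $T^3=T^2+T+1$. For spherical pans (closed balls of radius $R$) in every dimension $d\ge2$, with common width $w>0$, the following hold. (1) Placement obliviousness holds for every inventory of at most three rings and fails at four rings: for $R=15$, $w=0.3$ and radii $\{10,5,4.9,4.8\}$ all four rings form the lex-max set, best fit does not place the $4.8$, and worst fit places all four. (2) For $R=15$, $w=0.505$, $I_1=\{10,5,4.99,4.50\}$ and $I_2=\{10,5,4.76,4.74\}$: in $I_1$ best fit fails and worst fit succeeds, in $I_2$ worst fit fails and best fit succeeds, and the observable state when the $5$ is to be placed is identical in both. These instances exclude every deterministic state-based rule (none attains the lex-max set on all instances), and every randomized state-based rule fails on some instance with probability at least $1/2$. (3) Let $\mathcal F$ be the family of four-ring instances with radii $1>t>p>q>0$, width $\omega>0$ and pan radius $R=1+t$, such that $p+q\le1-\omega$ and balls of radii $1,p,q$ do not pack in a ball of radius $1+t$ in $\mathbb R^d$. Then $\inf_{\mathcal F}\rho=T$, and the infimum is not attained at positive width. (4) Let $\tau_d$ be the infimum of $\rho$ over all instances with spherical pan in $\mathbb R^d$ on which some descending greedy execution fails to place the lex-max set, and let $\tau_{4,d}$ be the same infimum restricted to inventories of at most four rings. Then $1\le\tau_d\le\varphi$, and $\tau_{4,d}=\varphi$, not attained.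
   Context: Model. Fix a width $w>0$ and a pan, here a closed ball of radius $R$ in $\mathbb R^d$. An inventory is a finite list of radii $r_1>r_2>\dots>r_n>0$; ring $i$ has outer radius $r_i$ and hole radius $\max(0,r_i-w)$. A placement of a set $S$ of rings is a forest: each ring of $S$ has as parent either the pan or another ring of $S$ with $r_{\mathrm{child}}\le r_{\mathrm{parent}}-w$, and the children of each common parent must be packable in the parent's region (the pan, or a ball of radius $r-w$ for the hole of a ring of radius $r$), i.e. closed balls having the children's outer radii can be positioned inside that region with pairwise disjoint interiors. Feasibility depends only on the parent assignment (siblings may be rearranged freely). $S$ is feasible if it has a placement. The lex-max set is obtained by scanning the rings in decreasing radius and including ring $i$ whenever the already included rings together with $i$ form a feasible set. A descending greedy processes the rings in decreasing radius; when ring $i$ is processed, a container (the pan or the hole of an already placed ring) admits it if the container's current children together with ring $i$ are packable in it; the ring receives some admitting container as its permanent parent, chosen by the placement rule, and is skipped only if no container admits it. Best fit chooses the admitting container of smallest capacity (radius), worst fit the one of largest capacity. An execution succeeds if it places exactly the lex-max set and fails otherwise. Placement obliviousness holds on an instance if every descending greedy execution succeeds. The observable state at a step consists of the containers, their capacities, their current occupants, the incoming ring, $R$ and $w$. A deterministic state-based rule is a function from states to admitting containers; a randomized state-based rule assigns to each state a probability distribution on admitting containers. $\rho=\max_i\bigl(\sum_{j>i}r_j\bigr)/r_i$. *)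

(* Defs.v *)
From mathcomp Require Import all_boot all_order all_algebra.
From mathcomp Require Import all_classical all_reals all_analysis.

Set Implicit Arguments.
Unset Strict Implicit.
Unset Printing Implicit Defensive.

Import Order.TTheory GRing.Theory Num.Theory.
Import numFieldNormedType.Exports.

Local Open Scope classical_set_scope.
Local Open Scope ring_scope.

(* The norm the library puts on row vectors is the sup norm, hence this one.
   The topology is the same, so interiors below are the usual ones. *)
Definition enorm (R : realType) (d : nat) (x : 'rV[R]_d) : R :=
  Num.sqrt (\sum_(i < d) x ord0 i ^+ 2).

Definition eball (R : realType) (d : nat) (c : 'rV[R]_d) (r : R) :
  set 'rV[R]_d := [set x | enorm (x - c) <= r].

Definition packable (R : realType) (d : nat) (rad : R) (s : seq R) : Prop :=
  exists c : 'I_(size s) -> 'rV[R]_d,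
    (forall i, eball (c i) s`_i `<=` eball 0 rad) /\
    (forall i j, i != j ->
       interior (eball (c i) s`_i) `&` interior (eball (c j) s`_j) = set0).

Record instance (R : realType) := Instance {
  width : R;
  pan : R;
  rings : seq R }.

(* The radii of an inventory are distinct, so a ring is identified with its
   outer radius throughout. *)
Definition valid (R : realType) (I : instance R) : Prop :=
  [/\ 0 < width I, 0 < pan I, all (fun x => 0 < x) (rings I) &
      sorted (fun x y => y < x) (rings I)].

(* [None] is the pan, [Some x] is the hole of the ring of radius [x]. *)
Definition container (R : realType) : Type := option R.

Definition capacity (R : realType) (I : instance R) (c : container R) : R :=
  if c is Some x then Num.max 0 (x - width I) else pan I.

(* Acyclicity of the parent assignment follows from [x <= y - width I], as the
   width is positive. *)
Definition feasible (R : realType) (d : nat) (I : instance R) (S : seq R) :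
  Prop :=
  exists par : R -> container R,
    (forall x y, x \in S -> par x = Some y -> y \in S /\ x <= y - width I) /\
    (forall c : container R, c \in None :: map Some S ->
       packable d (capacity I c) [seq x <- S | par x == c]).

Definition lexmax (R : realType) (d : nat) (I : instance R) : seq R :=
  foldl (fun S x => if `[< feasible d I (rcons S x) >] then rcons S x else S)
        [::] (rings I).

(* Placed rings with their parents, in order of placement. *)
Definition assignment (R : realType) : Type := seq (R * container R).

Definition placed (R : realType) (a : assignment R) : seq R := map fst a.

Record state (R : realType) := State {
  st_containers : seq (container R);
  st_capacity : container R -> R;
  st_occupants : container R -> seq R;
  st_ring : R;
  st_pan : R;
  st_width : R }.

Definition observe (R : realType) (I : instance R) (a : assignment R) (x : R) :
  state R :=
  State (None :: map Some (placed a)) (capacity I)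
        (fun c => [seq b.1 | b <- a & b.2 == c]) x (pan I) (width I).

Definition admits (R : realType) (d : nat) (st : state R) (c : container R) :
  Prop :=
  c \in st_containers st /\
  packable d (st_capacity st c) (rcons (st_occupants st c) (st_ring st)).

Definition placement_rule (R : realType) : Type :=
  state R -> container R -> Prop.

(* [run d ch I s a]: some descending greedy obeying the rule [ch] reaches the
   assignment [a] after processing the rings [s]. *)
Inductive run (R : realType) (d : nat) (ch : placement_rule R)
    (I : instance R) : seq R -> assignment R -> Prop :=
| run_start : run d ch I [::] [::]
| run_place s a x c : run d ch I s a ->
    admits d (observe I a x) c -> ch (observe I a x) c ->
    run d ch I (rcons s x) (rcons a (x, c))
| run_skip s a x : run d ch I s a ->
    (forall c, ~ admits d (observe I a x) c) ->
    run d ch I (rcons s x) a.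

Definition execution (R : realType) (d : nat) (ch : placement_rule R)
    (I : instance R) (a : assignment R) : Prop := run d ch I (rings I) a.

Definition unrestricted (R : realType) : placement_rule R := fun _ _ => True.

Definition best_fit (R : realType) (d : nat) : placement_rule R :=
  fun st c => forall c', admits d st c' -> st_capacity st c <= st_capacity st c'.

Definition worst_fit (R : realType) (d : nat) : placement_rule R :=
  fun st c => forall c', admits d st c' -> st_capacity st c' <= st_capacity st c.

Definition always_places (R : realType) (d : nat) (ch : placement_rule R)
    (I : instance R) (P : seq R -> Prop) : Prop :=
  (exists a, execution d ch I a) /\
  (forall a, execution d ch I a -> P (placed a)).

(* [placed a] and [lexmax d I] both list their rings in decreasing order, so
   equality of lists is equality of sets. *)
Definition succeeds (R : realType) (d : nat) (ch : placement_rule R)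
    (I : instance R) : Prop :=
  always_places d ch I (fun S => S = lexmax d I).

Definition fails (R : realType) (d : nat) (ch : placement_rule R)
    (I : instance R) : Prop :=
  always_places d ch I (fun S => S <> lexmax d I).

Definition oblivious (R : realType) (d : nat) (I : instance R) : Prop :=
  forall a, execution d (@unrestricted R) I a -> placed a = lexmax d I.

Definition deterministic_rule (R : realType) (d : nat)
    (f : state R -> container R) : Prop :=
  forall st, (exists c, admits d st c) -> admits d st (f st).

Definition follow (R : realType) (f : state R -> container R) :
  placement_rule R := fun st c => c = f st.

(* [undup] matters only for states that never arise in an execution: there the
   containers are distinct. *)
Definition randomized_rule (R : realType) (d : nat)
    (mu : state R -> container R -> R) : Prop :=
  forall st, (exists c, admits d st c) ->
    [/\ forall c, 0 <= mu st c,
        forall c, ~ admits d st c -> mu st c = 0 &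
        \sum_(c <- undup (st_containers st)) mu st c = 1].

(* Probability that the greedy following [mu] ends outside the lex-max set,
   from assignment [a] with the rings [s] still to be processed. *)
Fixpoint fail_prob_from (R : realType) (d : nat)
    (mu : state R -> container R -> R) (I : instance R) (s : seq R)
    (a : assignment R) : R :=
  if s is x :: s' then
    let st := observe I a x in
    if `[< exists c, admits d st c >] then
      \sum_(c <- undup (st_containers st))
        mu st c * fail_prob_from d mu I s' (rcons a (x, c))
    else fail_prob_from d mu I s' a
  else (placed a != lexmax d I)%:R.

Definition fail_prob (R : realType) (d : nat)
    (mu : state R -> container R -> R) (I : instance R) : R :=
  fail_prob_from d mu I (rings I) [::].

Definition rho (R : realType) (I : instance R) : R :=
  let s := rings I in
  \big[Num.max/0]_(i < size s)
    ((\sum_(j < size s | (i < j)%N) s`_j) / s`_i).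

Definition crossing_family (R : realType) (d : nat) : set (instance R) :=
  [set I | exists t p q w : R,
    [/\ 1 > t, t > p, p > q & q > 0] /\ w > 0 /\ p + q <= 1 - w /\
    ~ packable d (1 + t) [:: 1; p; q] /\
    I = Instance w (1 + t) [:: 1; t; p; q]].

Definition failing (R : realType) (d : nat) : set (instance R) :=
  [set I | valid I /\
    exists a, execution d (@unrestricted R) I a /\ placed a <> lexmax d I].

Definition failing4 (R : realType) (d : nat) : set (instance R) :=
  [set I | failing d I /\ (size (rings I) <= 4)%N].

Definition tau (R : realType) (d : nat) : R := inf (@rho R @` failing d).

Definition tau4 (R : realType) (d : nat) : R := inf (@rho R @` failing4 d).

(* Main.v *)
Require Import Defs.
From mathcomp Require Import all_boot all_order all_algebra.
From mathcomp Require Import all_classical all_reals all_analysis.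
From mathcomp Require Import ring lra.
Set Implicit Arguments.
Unset Strict Implicit.
Unset Printing Implicit Defensive.
Import Order.TTheory GRing.Theory Num.Theory.
Import numFieldNormedType.Exports.
Local Open Scope classical_set_scope.
Local Open Scope ring_scope.

(** Only two facts about packings carry the proof. Balls whose radii add up to
    at most [N] fit in a row along a diameter of a ball of radius [N]; for two
    balls this is also necessary. For three balls, planar packings are built
    with two balls touching both the third one and the pan
    ([packs3_planar]), and packings are excluded by the nonnegativity of the
    squared length of a combination of the centers ([packs3_obstruction]).
    When [a] and [b] span a diameter, both say that a ball [e] fits beside them
    exactly if [e (a^2 + a b + b^2) <= a b (a + b)].

    The placement built by a greedy is always feasible, so an execution misses
    the lex-max set only if it gets stuck: it skips a ring [x] that fits after
    rearranging the rings already placed ([run_lex_or_stuck]). With at most two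
    rings placed this is impossible. With three rings [p > q > r] placed,
    comparing the two placements shows that [x] does not fit beside [p] and [q]
    in a pan of radius [p + q] ([stuck3]). Then [r] and [x] are both larger
    than the gap beside [p] and [q], and [golden_bound] turns this into
    [rho > phi]; inventories close to [1, 1/phi, 1/2, 1/2] show that [phi] is
    the infimum. For any number of rings, [rho <= 1] means that each ring is at
    least as large as all the smaller ones together; then an exchange argument
    ([superincreasing_not_stuck]) rules out stuck executions.

    All the concrete instances are of one kind, called a dilemma below: the
    second ring may go to the pan or to the hole of the first one, and this
    choice forces the rest of the execution. The two numerical instances of the
    second part look alike when the choice is made, but require different
    choices; so a deterministic rule fails on one of them, and the failure
    probabilities of a randomized rule add up to at least one.

    For the crossing family, balls [1, p, q] with [p < t] that do not pack in a
    ball of radius [1 + t] satisfy [p + q > t + t (1 + t) / (1 + t + t^2)]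
    ([crossing_sum]). Since [p + q < 1], this forces [t T < 1], whence
    [(p + q) / t > T]; equality is approached for [p] tending to [t] and [t]
    tending to [1 / T]. *)

(** * Euclidean norm *)

Section EuclideanNorm.
Variables (R : realType) (d : nat).
Implicit Types x y z : 'rV[R]_d.

Lemma enorm_ge0 x : 0 <= enorm x.
Proof. exact: sqrtr_ge0. Qed.

Lemma sqr_enorm x : enorm x ^+ 2 = \sum_(i < d) x ord0 i ^+ 2.
Proof. by rewrite sqr_sqrtr // sumr_ge0 // => i _; rewrite sqr_ge0. Qed.

Lemma enorm_le x r : 0 <= r ->
  (enorm x <= r) = (\sum_(i < d) x ord0 i ^+ 2 <= r ^+ 2).
Proof.
by move=> r0; rewrite -sqr_enorm ler_pXn2r // nnegrE // enorm_ge0.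
Qed.

Lemma enorm_lt x r : 0 <= r ->
  (enorm x < r) = (\sum_(i < d) x ord0 i ^+ 2 < r ^+ 2).
Proof.
by move=> r0; rewrite -sqr_enorm ltr_pXn2r // nnegrE // enorm_ge0.
Qed.

Lemma enormZ a x : enorm (a *: x) = `|a| * enorm x.
Proof.
rewrite /enorm -sqrtr_sqr -sqrtrM ?sqr_ge0 // big_distrr /=.
by congr Num.sqrt; apply: eq_bigr => i _; rewrite mxE exprMn.
Qed.

Lemma enormN x : enorm (- x) = enorm x.
Proof. by rewrite -scaleN1r enormZ normrN1 mul1r. Qed.

Lemma enormC x y : enorm (x - y) = enorm (y - x).
Proof. by rewrite -enormN opprB. Qed.

Lemma enorm0 : enorm (0 : 'rV[R]_d) = 0.
Proof. by rewrite -(scale0r (0 : 'rV[R]_d)) enormZ normr0 mul0r. Qed.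

Lemma cauchy_schwarz x y :
  (\sum_(i < d) x ord0 i * y ord0 i) ^+ 2 <= enorm x ^+ 2 * enorm y ^+ 2.
Proof.
rewrite !sqr_enorm.
set A := \sum_(i < d) x _ _ ^+ 2; set B := \sum_(i < d) y _ _ ^+ 2.
set C := \sum_(i < d) _ * _.
have B0 : 0 <= B by apply: sumr_ge0 => i _; rewrite sqr_ge0.
have : 0 <= B * (A * B - C ^+ 2).
  have -> : B * (A * B - C ^+ 2) =
      \sum_(i < d) (B * x ord0 i - C * y ord0 i) ^+ 2.
    rewrite (eq_bigr (fun i => B ^+ 2 * x ord0 i ^+ 2
      - 2 * B * C * (x ord0 i * y ord0 i) + C ^+ 2 * y ord0 i ^+ 2));
      last by move=> i _; ring.
    rewrite big_split /= sumrB -!mulr_sumr -/A -/B -/C; ring.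
  by apply: sumr_ge0 => i _; rewrite sqr_ge0.
have [B1|] := ltP 0 B; first by rewrite pmulr_rge0 // subr_ge0.
move=> B1 _; have B2 : B = 0 by apply/eqP; rewrite eq_le B0 B1.
have C0 : C = 0.
  apply: big1 => i _; apply/eqP; rewrite mulf_eq0; apply/orP; right.
  have /psumr_eq0P/(_ i isT)/eqP : B = 0 := B2.
  by rewrite sqrf_eq0; apply => j _; rewrite sqr_ge0.
by rewrite C0 B2 mulr0 expr0n.
Qed.

Lemma enormD x y : enorm (x + y) <= enorm x + enorm y.
Proof.
have nx := enorm_ge0 x; have ny := enorm_ge0 y.
rewrite enorm_le ?addr_ge0 //.
rewrite (eq_bigr (fun i => x ord0 i ^+ 2 + 2 * (x ord0 i * y ord0 i)
  + y ord0 i ^+ 2)); last by move=> i _; rewrite mxE; ring.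
rewrite !big_split /= -mulr_sumr -!sqr_enorm.
have : \sum_(i < d) x ord0 i * y ord0 i <= enorm x * enorm y.
  rewrite (le_trans (ler_norm _)) // -(@ler_pXn2r _ 2) ?nnegrE ?mulr_ge0 //.
  by rewrite exprMn real_normK ?num_real // cauchy_schwarz.
by move=> ?; nra.
Qed.

Lemma enorm_dist x y z : enorm (x - z) <= enorm (x - y) + enorm (y - z).
Proof. by rewrite (le_trans _ (enormD _ _)) // addrA subrK. Qed.

Lemma coord_le_enorm x i : `|x ord0 i| <= enorm x.
Proof.
rewrite -sqrtr_sqr /enorm ler_wsqrtr // (bigD1 i) //= lerDl.
by rewrite sumr_ge0 // => j _; rewrite sqr_ge0.
Qed.

(** A point at distance exactly [r] from the center leaves the closed ball when
    pushed outwards. *)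
Lemma interior_eball_lt (c z : 'rV[R]_d) (r : R) : 0 < r ->
  interior (eball c r) z -> enorm (z - c) < r.
Proof.
move=> r0 /nbhs_ballP[e /= e0 He].
set M := enorm (z - c); have M0 : 0 <= M := enorm_ge0 _.
pose dl := e / (2 * (M + 1)).
have M1 : 0 < M + 1 by lra.
have dl0 : 0 < dl by rewrite divr_gt0 // mulr_gt0.
have dlM : dl * M < e.
  have -> : dl * M = e * (M / (2 * (M + 1))) by rewrite /dl; field; lra.
  by rewrite gtr_pMr // ltr_pdivrMr ?mulr_gt0 //; lra.
have : eball c r (z + dl *: (z - c)).
  apply: He; split=> // i j.
  rewrite /ball /= !mxE opprD addNKr normrN normrM gtr0_norm //.
  apply: le_lt_trans dlM; rewrite ler_pM2l // ord1.
  by have := coord_le_enorm (z - c) j; rewrite !mxE.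
rewrite /eball /=.
have -> : z + dl *: (z - c) - c = (1 + dl) *: (z - c).
  by rewrite scalerDl scale1r addrAC.
rewrite enormZ gtr0_norm ?addr_gt0 // -/M.
by have [|] := ltP M r => // rM; nra.
Qed.

(** The Euclidean norm is continuous for the topology of the sup norm, as a
    function of the coordinates. *)
Lemma lt_interior_eball (c z : 'rV[R]_d) (r : R) :
  enorm (z - c) < r -> interior (eball c r) z.
Proof.
move=> zr.
have r0 : 0 < r := le_lt_trans (enorm_ge0 _) zr.
have cnt : continuous (fun x : 'rV[R]_d => \sum_(i < d) (x ord0 i - c ord0 i) ^+ 2).
  apply: (@continuous_big _ _ +%R 0 xpredT); first exact: add_continuous.
  move=> i _ x.
  apply: (@continuous_comp _ _ _ (fun M : 'rV[R]_d => M ord0 i - c ord0 i)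
    (fun u => u ^+ 2)); last exact: exprn_continuous.
  apply: continuousB; last exact: cst_continuous.
  exact: (@coord_continuous R 1 d ord0 i x).
rewrite (enorm_lt _ (ltW r0)) in zr.
have zr' : \sum_(i < d) (z ord0 i - c ord0 i) ^+ 2 < r ^+ 2.
  by apply: le_lt_trans zr; rewrite le_eqVlt; apply/orP; left; apply/eqP;
    apply: eq_bigr => i _; rewrite !mxE.
have H : nbhs z [set x : 'rV[R]_d | \sum_(i < d) (x ord0 i - c ord0 i) ^+ 2 < r ^+ 2].
  exact: cnt z _ (lt_nbhsl zr').
rewrite /interior /=; apply: filterS H => x /= xr.
rewrite /eball /= ltW // enorm_lt ?ltW //.
by under eq_bigr do rewrite !mxE.
Qed.

End EuclideanNorm.

(** * Packings as distance conditions *)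

Section Plane.
Variables (R : realType) (d : nat) (hd : (2 <= d)%N).

(** A copy of the Euclidean plane inside the ambient space: all packings
    constructed below are planar. *)
Definition plane (x y : R) : 'rV[R]_d :=
  \row_(j < d) if val j == 0%N then x else if val j == 1%N then y else 0.

Lemma planeB x y x' y' : plane x y - plane x' y' = plane (x - x') (y - y').
Proof.
apply/rowP => j; rewrite !mxE.
by case: ifP => // _; case: ifP => // _; rewrite subr0.
Qed.

Lemma sqr_enorm_plane x y : enorm (plane x y) ^+ 2 = x ^+ 2 + y ^+ 2.
Proof.
rewrite sqr_enorm /plane; case: d hd => [|[|d']] // _.
rewrite !big_ord_recl !mxE /= big1 ?addr0 // => i _.
by rewrite mxE /= expr0n.
Qed.

Lemma enorm_line x : enorm (plane x 0) = `|x|.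
Proof.
apply/eqP; rewrite -(@eqrXn2 _ 2) ?enorm_ge0 // sqr_enorm_plane.
by rewrite expr0n addr0 real_normK ?num_real.
Qed.

Lemma sub_eball (c : 'rV[R]_d) (r N : R) : 0 <= r ->
  (eball c r `<=` eball 0 N) <-> enorm c + r <= N.
Proof.
move=> r0; split=> [sub|cN x]; last first.
  rewrite /eball /= subr0 => xc; apply: le_trans cN.
  by rewrite -{1}(subrK c x) addrC (le_trans (enormD _ _)) // lerD2l.
have [c0|c0] := eqVneq (enorm c) 0.
  have := sub (c + plane r 0).
  rewrite /eball /= subr0 addrAC subrr add0r enorm_line ger0_norm // c0 add0r.
  have := enorm_dist (plane r 0) (- c) 0.
  rewrite !subr0 !opprK enormN c0 addr0 addrC enorm_line ger0_norm //.
  by move=> h1 /(_ (lexx _)); apply: le_trans.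
have c1 : 0 < enorm c by rewrite lt_def c0 enorm_ge0.
have := sub (c + (r / enorm c) *: c).
have -> : c + (r / enorm c) *: c = (1 + r / enorm c) *: c.
  by rewrite scalerDl scale1r.
have k0 : 0 <= r / enorm c by rewrite divr_ge0 // ltW.
rewrite /eball /= subr0 scalerDl scale1r addrAC subrr add0r.
rewrite -[X in enorm (X + _)]scale1r -scalerDl !enormZ.
by rewrite !ger0_norm ?addr_ge0 // mulrDl mul1r divfK // => /(_ (lexx _)).
Qed.

Lemma disjoint_interiors (c c' : 'rV[R]_d) (r r' : R) : 0 < r -> 0 < r' ->
  (interior (eball c r) `&` interior (eball c' r') = set0) <->
  r + r' <= enorm (c - c').
Proof.
move=> r0 r0'; split=> [dis|far].
  rewrite leNgt; apply/negP => near.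
  have s0 : 0 < r + r' by rewrite addr_gt0.
  (* the point dividing the segment of the centers in the ratio of the radii *)
  pose z := c + (r / (r + r')) *: (c' - c).
  suff : set0 z by [].
  rewrite -dis; split; apply: lt_interior_eball.
    rewrite /z addrAC subrr add0r enormZ gtr0_norm ?divr_gt0 // enormC.
    by rewrite mulrAC ltr_pdivrMr // ltr_pM2l.
  have -> : z - c' = (r' / (r + r')) *: (c - c').
    have -> : r' / (r + r') = 1 - r / (r + r') by field; lra.
    by rewrite /z scalerBl scale1r -(opprB c c') scalerN addrAC.
  rewrite enormZ gtr0_norm ?divr_gt0 //.
  by rewrite mulrAC ltr_pdivrMr // ltr_pM2l.
apply/seteqP; split=> z //= -[/(interior_eball_lt r0) h /(interior_eball_lt r0') h'].
have := enorm_dist c z c'; rewrite (enormC c z); lra.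
Qed.

End Plane.

Section Packs.
Variables (R : realType) (d : nat) (hd : (2 <= d)%N).

(** For distinct positive radii this is [packable] (see [packableP]); the
    centers are attached to the radii instead of their positions, so that only
    the set of radii matters and no reordering ever has to be discussed. *)
Definition packs (N : R) (s : seq R) : Prop :=
  exists c : R -> 'rV[R]_d,
    (forall x, x \in s -> enorm (c x) + x <= N) /\
    (forall x y, x \in s -> y \in s -> x != y -> x + y <= enorm (c x - c y)).

Lemma packableP (N : R) (s : seq R) : all (fun x => 0 < x) s -> uniq s ->
  packable d N s <-> packs N s.
Proof.
move=> /allP s0 us; split=> -[c [inN sep]].
  pose c' x := if insub (index x s) is Some i then c i else 0.
  have cE x (xs : x \in s) :
      exists2 i : 'I_(size s), s`_i = x & c' x = c i.
    have lt : (index x s < size s)%N by rewrite index_mem.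
    by exists (Ordinal lt); rewrite ?nth_index // /c' insubT.
  exists c'; split=> [x xs|x y xs ys xy].
    have [i <- ->] := cE x xs.
    by apply/sub_eball => //; rewrite ltW // s0 ?mem_nth.
  have [i ix ->] := cE x xs; have [j jy ->] := cE y ys.
  rewrite -ix -jy; apply/disjoint_interiors; rewrite ?s0 ?mem_nth //.
  by apply: sep; apply: contra_neq xy => ij; rewrite -ix -jy ij.
exists (fun i => c s`_i); split=> [i|i j ij].
  by apply/sub_eball => //; [rewrite ltW // s0 ?mem_nth|exact/inN/mem_nth].
apply/disjoint_interiors; rewrite ?s0 ?mem_nth //.
by apply: sep; rewrite ?mem_nth // nth_uniq.
Qed.

Lemma packs_dom (f : R -> R) (N N' : R) (s t : seq R) : N <= N' ->
  (forall x, x \in t -> f x \in s /\ x <= f x) -> {in t &, injective f} ->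
  packs N s -> packs N' t.
Proof.
move=> NN' ft fI [c [inN sep]]; exists (c \o f); split=> [x xt|x y xt yt xy] /=.
  have [fs le] := ft _ xt; have := inN _ fs; lra.
have [fs le] := ft _ xt; have [gs le'] := ft _ yt.
have fxy : f x != f y by apply: contra_neq xy; exact: fI.
have := sep _ _ fs gs fxy; lra.
Qed.

Lemma packs_sub (N : R) (s t : seq R) : {subset t <= s} ->
  packs N s -> packs N t.
Proof. by move=> st; apply: (@packs_dom id) => // x /st. Qed.

Lemma packs_le (N N' : R) (s : seq R) : N <= N' -> packs N s -> packs N' s.
Proof. by move=> NN'; apply: (@packs_dom id). Qed.

(** Intervals of half-lengths [L] laid end to end. *)
Lemma row_layout (L : seq R) (y : R) : all (fun x => 0 < x) L ->
  \sum_(x <- L) x <= y ->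
  exists off : R -> R, (forall x, x \in L -> `|off x| + x <= y) /\
    (forall x z, x \in L -> z \in L -> x != z -> x + z <= `|off x - off z|).
Proof.
move=> L0 Ly.
suff : exists off : R -> R,
    (forall x, x \in L -> x <= off x /\ off x + x <= 2 * \sum_(x <- L) x) /\
    (forall x z, x \in L -> z \in L -> x != z -> x + z <= `|off x - off z|).
  move=> [off [hin hsep]]; exists (fun x => off x - \sum_(x <- L) x).
  split=> [x xL|x z xL zL xz].
    rewrite -lerBrDr ler_norml; have [] := hin _ xL; lra.
  by have := hsep _ _ xL zL xz; rewrite opprB addrA subrK.
elim: L L0 {Ly} => [|x L IH] /=; first by exists id.
move=> /andP[x0 L0]; have [off [hin hsep]] := IH L0.
have S0 : 0 <= \sum_(x <- L) x.
  by rewrite big_seq sumr_ge0 // => z zL; rewrite ltW // (allP L0).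
exists (fun z => if z == x then x else off z + 2 * x); split=> [z|z u].
  rewrite inE big_cons; case: eqP => [->|_ /= zL]; first by lra.
  by have [] := hin _ zL; lra.
rewrite !inE; case: eqP => [->|_]; case: eqP => [->|_] //=.
- by rewrite eqxx.
- move=> _ uL _; have [] := hin _ uL; rewrite ler_normr; lra.
- move=> zL _ _; have [] := hin _ zL; rewrite ler_normr; lra.
- move=> zL uL zu; have := hsep _ _ zL uL zu.
  by have -> : off z + 2 * x - (off u + 2 * x) = off z - off u by ring.
Qed.

(** Balls whose radii add up to at most [y] fit in a row along a diameter of
    the ball [y], so that they can take its place. *)
Lemma packs_subst (N y : R) (s L t : seq R) : all (fun x => 0 < x) L ->
  \sum_(x <- L) x <= y -> y \in s ->
  (forall z, z \in t -> z \in L \/ z \in s /\ z != y) ->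
  packs N s -> packs N t.
Proof.
move=> L0 Ly ys st [c [inN sep]].
have [off [hin hsep]] := row_layout L0 Ly.
have out z u : z \in L -> u \in s -> u != y ->
    z + u <= enorm (c y + plane d (off z) 0 - c u).
  move=> zL us uy.
  have := sep _ _ ys us; rewrite eq_sym uy => /(_ isT).
  have := enorm_dist (c y) (c y + plane d (off z) 0) (c u).
  have := hin _ zL.
  have -> : c y - (c y + plane d (off z) 0) = - plane d (off z) 0.
    by rewrite opprD addrA subrr sub0r.
  rewrite enormN enorm_line //; lra.
exists (fun z => if z \in L then c y + plane d (off z) 0 else c z).
split=> [z zt|z u zt ut zu].
  case: ifP (st _ zt) => [zL _|_ [//|[zs _]]]; last exact: inN.
  have := enormD (c y) (plane d (off z) 0); rewrite enorm_line //.
  have := inN _ ys; have := hin _ zL; lra.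
case: ifP (st _ zt) => [zL _|_ [//|[zs zy]]];
  case: ifP (st _ ut) => [uL _|_ [//|[us uy]]].
- rewrite opprD addrACA subrr add0r planeB subrr enorm_line //.
  exact: hsep.
- exact: out.
- by rewrite addrC enormC; exact: out.
- exact: sep.
Qed.

Lemma packs1 (N x : R) : packs N [:: x] <-> x <= N.
Proof.
split=> [[c [inN _]]|xN].
  by have := inN x; rewrite inE eqxx => /(_ isT); have := enorm_ge0 (c x); lra.
exists (fun=> 0); split=> [y|y z]; rewrite !inE.
  by move=> /eqP ->; rewrite enorm0 add0r.
by move=> /eqP -> /eqP ->; rewrite eqxx.
Qed.

Lemma packs2 (N x y : R) : 0 < x -> 0 < y -> x != y ->
  packs N [:: x; y] <-> x + y <= N.
Proof.
move=> x0 y0 xy; split=> [[c [inN sep]]|xyN].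
  have := sep x y; rewrite !inE !eqxx orbT => /(_ isT isT xy).
  have := inN x; rewrite !inE eqxx => /(_ isT).
  have := inN y; rewrite !inE eqxx orbT => /(_ isT).
  by have := enorm_dist (c x) 0 (c y); rewrite subr0 sub0r enormN; lra.
apply: (@packs_subst _ N [:: N] [:: x; y]).
- by rewrite /= x0 y0.
- by rewrite !big_cons big_nil addr0.
- exact: mem_head.
- by left.
- exact/packs1.
Qed.

(** The squared length of a nonnegative combination of the three centers,
    expanded by [|al u + be v + ga w|^2 = (al + be + ga) (al |u|^2 + ...) -
    al be |u - v|^2 - ...], is nonnegative. Suitable weights turn this into
    the obstruction to every three-ball packing ruled out below. *)
Lemma packs3_obstruction (al be ga N x y z : R) :
  0 <= al -> 0 <= be -> 0 <= ga -> 0 < x -> 0 < y -> 0 < z ->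
  x != y -> x != z -> y != z -> packs N [:: x; y; z] ->
  al * be * (x + y) ^+ 2 + al * ga * (x + z) ^+ 2 + be * ga * (y + z) ^+ 2 <=
  (al + be + ga) *
    (al * (N - x) ^+ 2 + be * (N - y) ^+ 2 + ga * (N - z) ^+ 2).
Proof.
move=> al0 be0 ga0 x0 y0 z0 xy xz yz [c [inN sep]].
have bnd u : u \in [:: x; y; z] -> enorm (c u) ^+ 2 <= (N - u) ^+ 2.
  move=> us; have := inN _ us; have := enorm_ge0 (c u).
  by move=> h1 h2; rewrite ler_pXn2r ?nnegrE //; lra.
have dst u v : u \in [:: x; y; z] -> v \in [:: x; y; z] -> 0 < u -> 0 < v ->
    u != v -> (u + v) ^+ 2 <= enorm (c u - c v) ^+ 2.
  move=> us vs u0 v0 uv; have := sep _ _ us vs uv; have := enorm_ge0 (c u - c v).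
  by move=> h1 h2; rewrite ler_pXn2r ?nnegrE //; lra.
have xs : x \in [:: x; y; z] by rewrite !inE eqxx.
have ys : y \in [:: x; y; z] by rewrite !inE eqxx orbT.
have zs : z \in [:: x; y; z] by rewrite !inE eqxx !orbT.
have key : 0 <= (al + be + ga) * (al * enorm (c x) ^+ 2 + be * enorm (c y) ^+ 2
    + ga * enorm (c z) ^+ 2) - al * be * enorm (c x - c y) ^+ 2
    - al * ga * enorm (c x - c z) ^+ 2 - be * ga * enorm (c y - c z) ^+ 2.
  rewrite !sqr_enorm !mulr_sumr -!big_split /= mulr_sumr -!sumrB.
  apply: sumr_ge0 => i _; rewrite !mxE.
  set u := c x _ _; set v := c y _ _; set w := c z _ _.
  rewrite [leRHS](_ : _ = (al * u + be * v + ga * w) ^+ 2) ?sqr_ge0 //; ring.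
have h1 := ler_wpM2l (mulr_ge0 al0 be0) (dst _ _ xs ys x0 y0 xy).
have h2 := ler_wpM2l (mulr_ge0 al0 ga0) (dst _ _ xs zs x0 z0 xz).
have h3 := ler_wpM2l (mulr_ge0 be0 ga0) (dst _ _ ys zs y0 z0 yz).
have s0 : 0 <= al + be + ga by rewrite !addr_ge0.
have h4 := ler_wpM2l s0 (ler_wpM2l al0 (bnd _ xs)).
have h5 := ler_wpM2l s0 (ler_wpM2l be0 (bnd _ ys)).
have h6 := ler_wpM2l s0 (ler_wpM2l ga0 (bnd _ zs)).
rewrite !mulrDr in key *; lra.
Qed.

(** The ball of radius [a] is pushed to the left of the pan; the balls [p] and
    [q] touch both it and the pan, one above and one below the axis. Their
    heights are [2 P / b] and [2 Q / b] for the square roots [P] and [Q], and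
    the hypothesis on [P] and [Q] says that they do not overlap. *)
Lemma packs3_planar (a b p q : R) : 0 < a -> 0 < b -> 0 < p <= b ->
  0 < q <= b ->
  b * p * q <= Num.sqrt (a * (a + b) * p * (b - p)) * q
             + Num.sqrt (a * (a + b) * q * (b - q)) * p ->
  packs (a + b) [:: a; p; q].
Proof.
move=> a0 b0 /andP[p0 pb] /andP[q0 qb].
have N0 : 0 < a + b by rewrite addr_gt0.
have bp : 0 <= b - p by rewrite subr_ge0.
have bq : 0 <= b - q by rewrite subr_ge0.
have pp : 0 <= a * (a + b) * p * (b - p) by rewrite !mulr_ge0 // ltW.
have qq : 0 <= a * (a + b) * q * (b - q) by rewrite !mulr_ge0 // ltW.
move: (sqr_sqrtr pp) (sqr_sqrtr qq) (sqrtr_ge0 (a * (a + b) * p * (b - p)))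
  (sqrtr_ge0 (a * (a + b) * q * (b - q))).
set P := Num.sqrt _; set Q := Num.sqrt _ => PP QQ P0 Q0 far.
have bn : b != 0 by rewrite gt_eqF.
pose X u := (a * u - (a + b) * (b - u)) / b.
pose ca := plane d (- b) 0.
pose cp := plane d (X p) (2 * P / b).
pose cq := plane d (X q) (- (2 * Q / b)).
have onrim u S : S ^+ 2 = a * (a + b) * u * (b - u) ->
    X u ^+ 2 + (2 * S / b) ^+ 2 = (a + b - u) ^+ 2.
  move=> SS; have -> : (2 * S / b) ^+ 2 = 4 * S ^+ 2 / b ^+ 2 by field.
  by rewrite SS /X; field.
have touch u S : S ^+ 2 = a * (a + b) * u * (b - u) ->
    (- b - X u) ^+ 2 + (2 * S / b) ^+ 2 = (a + u) ^+ 2.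
  move=> SS; have -> : (2 * S / b) ^+ 2 = 4 * S ^+ 2 / b ^+ 2 by field.
  by rewrite SS /X; field.
have in_ u S : 0 < u <= b -> S ^+ 2 = a * (a + b) * u * (b - u) ->
    enorm (plane d (X u) (2 * S / b)) + u <= a + b.
  move=> /andP[u0 ub] SS; rewrite -lerBrDr -(@ler_pXn2r _ 2) ?nnegrE ?enorm_ge0 //;
    last by lra.
  by rewrite sqr_enorm_plane // onrim.
have sep_ u S : 0 < u <= b -> S ^+ 2 = a * (a + b) * u * (b - u) ->
    a + u <= enorm (ca - plane d (X u) (2 * S / b)).
  move=> /andP[u0 ub] SS; rewrite -(@ler_pXn2r _ 2) ?nnegrE ?enorm_ge0 //;
    last by lra.
  by rewrite planeB sqr_enorm_plane // sub0r sqrrN touch.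
have QN : (- Q) ^+ 2 = a * (a + b) * q * (b - q) by rewrite sqrrN.
have cqE : cq = plane d (X q) (2 * - Q / b) by rewrite /cq mulrN mulNr.
have sep_pq : p + q <= enorm (cp - cq).
  rewrite -(@ler_pXn2r _ 2) ?nnegrE ?enorm_ge0 //; last by rewrite addr_ge0 // ltW.
  rewrite planeB sqr_enorm_plane // opprK.
  have far2 : (b * p * q) ^+ 2 <= (P * q + Q * p) ^+ 2.
    by rewrite ler_pXn2r ?nnegrE ?addr_ge0 ?mulr_ge0 ?(ltW b0) ?(ltW p0) ?(ltW q0).
  have {}far2 : p * q * (b ^+ 2 * p * q) <=
      p * q * (a * (a + b) * ((b - p) * q + (b - q) * p) + 2 * P * Q).
    move: far2; have -> : (P * q + Q * p) ^+ 2 =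
        P ^+ 2 * q ^+ 2 + Q ^+ 2 * p ^+ 2 + p * q * (2 * P * Q) by ring.
    by rewrite PP QQ; lra.
  rewrite ler_pM2l ?mulr_gt0 // in far2.
  rewrite -(ler_pM2r (exprn_gt0 2 b0)).
  have -> : ((X p - X q) ^+ 2 + (2 * P / b + 2 * Q / b) ^+ 2) * b ^+ 2 =
      ((a + (a + b)) * (p - q)) ^+ 2 + 4 * (P ^+ 2 + Q ^+ 2 + 2 * P * Q).
    by rewrite /X; field.
  by rewrite PP QQ; lra.
exists (fun u => if u == a then ca else if u == p then cp else cq).
have ina : enorm ca + a <= a + b by rewrite enorm_line // normrN gtr0_norm // addrC.
have inp : enorm cp + p <= a + b by apply: in_ => //; rewrite p0.
have inq : enorm cq + q <= a + b by rewrite cqE; apply: in_ => //; rewrite q0.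
have ap : a + p <= enorm (ca - cp) by apply: sep_ => //; rewrite p0.
have aq : a + q <= enorm (ca - cq) by rewrite cqE; apply: sep_ => //; rewrite q0.
split=> [u|u v]; rewrite !inE.
  by case: eqP => [->|_] //=; case: eqP => [->|_] //= /eqP ->.
case: (eqVneq u a) => [->|ua]; case: (eqVneq v a) => [->|va] /=.
- by [].
- by move=> _; case: (eqVneq v p) => [->|vp] //= /eqP ->.
- by case: (eqVneq u p) => [->|up] /=; [|move=> /eqP ->]; rewrite addrC enormC.
- case: (eqVneq u p) => [->|up]; case: (eqVneq v p) => [->|vp] /=.
  + by [].
  + by move=> _ /eqP ->.
  + by move=> /eqP -> _ _; rewrite addrC enormC.
  + by move=> /eqP -> /eqP ->; rewrite eqxx.
Qed.

(** The largest ball that fits beside two touching balls [a] and [b] spanning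
    a diameter of the pan; its curvature is [1/a + 1/b - 1/(a+b)]. *)
Lemma packs3_diameter (a b e : R) : 0 < a -> 0 < b -> 0 < e <= b ->
  e * (a ^+ 2 + a * b + b ^+ 2) <= a * b * (a + b) ->
  packs (a + b) [:: a; b; e].
Proof.
move=> a0 b0 /andP[e0 eb] small; apply: packs3_planar; rewrite ?b0 ?e0 //=.
rewrite subrr mulr0 sqrtr0 mul0r add0r.
suff h : b * e <= Num.sqrt (a * (a + b) * e * (b - e)).
  by have := ler_wpM2l (ltW b0) h; lra.
rewrite -(@ler_pXn2r _ 2) ?nnegrE ?sqrtr_ge0 ?mulr_ge0 ?(ltW b0) ?(ltW e0) //.
rewrite sqr_sqrtr; last first.
  by rewrite !mulr_ge0 ?subr_ge0 ?addr_ge0 ?(ltW a0) ?(ltW b0) ?(ltW e0).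
by have := ler_wpM2l (ltW e0) small; lra.
Qed.

End Packs.

Lemma packs3_dom (R : realType) (d : nat) (N x y z x' y' z' : R) :
  x' <= x -> y' <= y -> z' <= z -> x' != y' -> x' != z' -> y' != z' ->
  x != y -> x != z -> y != z ->
  packs d N [:: x; y; z] -> packs d N [:: x'; y'; z'].
Proof.
move=> xx yy zz xy' xz' yz' xy xz yz.
apply: (@packs_dom _ _ (fun u => if u == x' then x else if u == y' then y else z)) => //.
  move=> u; rewrite !inE => /or3P[] /eqP ->; rewrite ?eqxx //.
    by rewrite (eq_sym y') (negbTE xy') eqxx orbT.
  by rewrite (eq_sym z') (negbTE xz') (eq_sym z') (negbTE yz') eqxx !orbT.
have [yx' zx' zy'] : [/\ y' != x', z' != x' & z' != y'].
  by rewrite (eq_sym y') (eq_sym z' x') (eq_sym z' y').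
have ne u v (t1 t2 : R) : u != v -> u = v -> t1 = t2 by move=> /eqP.
have ne' u v (t1 t2 : R) : u != v -> v = u -> t1 = t2 by move=> /eqP nuv /esym.
move=> u v; rewrite !inE => /or3P[] /eqP -> /or3P[] /eqP -> //;
  rewrite ?eqxx ?(negbTE xy') ?(negbTE yx') ?(negbTE zx') ?(negbTE zy') //;
  by [apply: ne | apply: ne'].
Qed.

(** * Placements *)

Section Placement.
Variables (R : realType) (d : nat) (hd : (2 <= d)%N).
Implicit Types (I : instance R) (S s : seq R) (a : assignment R).

Lemma hole1 I x y : 0 < x ->
  packs d (capacity I (Some y)) [:: x] <-> x <= y - width I.
Proof. by move=> x0; rewrite packs1 /= le_max leNgt x0. Qed.

Lemma hole2 I x z y : 0 < x -> 0 < z -> x != z ->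
  packs d (capacity I (Some y)) [:: x; z] <-> x + z <= y - width I.
Proof.
by move=> x0 z0 xz; rewrite packs2 //= le_max leNgt addr_gt0.
Qed.

Definition containers S : seq (container R) := None :: map Some S.

Lemma mem_hole S y : (Some y \in containers S) = (y \in S).
Proof. by rewrite inE /= mem_map // => u v []. Qed.

(** The parent function is exposed, unlike in [feasible], because two
    placements of the same rings will be compared. *)
Definition placement I S (par : R -> container R) : Prop :=
  (forall x y, x \in S -> par x = Some y -> y \in S /\ x <= y - width I) /\
  (forall c, c \in containers S ->
     packs d (capacity I c) [seq x <- S | par x == c]).

Lemma feasibleP I S : all (fun x => 0 < x) S -> uniq S ->
  feasible d I S <-> exists par, placement I S par.
Proof.
move=> S0 uS; split=> -[par [p1 p2]]; exists par; split=> // c cS;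
  have := p2 c cS; rewrite packableP ?filter_uniq //;
  by apply/allP => x; rewrite mem_filter => /andP[_]; apply/allP.
Qed.

Lemma placement_packs I S par c s : placement I S par -> c \in containers S ->
  (forall x, x \in s -> x \in S /\ par x = c) -> packs d (capacity I c) s.
Proof.
move=> [_ p2] cS sS; apply: packs_sub (p2 c cS) => x xs.
by have [xS /eqP pc] := sS _ xs; rewrite mem_filter pc.
Qed.

Lemma placement_prefix I S x par : all (fun y => x < y) S -> 0 < width I ->
  0 < x -> placement I (rcons S x) par -> placement I S par.
Proof.
move=> /allP xS w0 x0 pl; split=> [y z yS yz|c cS].
  have [] := pl.1 y z _ yz; first by rewrite mem_rcons inE yS orbT.
  rewrite mem_rcons inE => /orP[/eqP -> |//] h; have := xS _ yS; lra.
apply: (placement_packs pl) => [|y].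
  by move: cS; rewrite !inE => /orP[->//|/mapP[u uS ->]]; rewrite mem_map ?mem_rcons
   ?inE ?uS ?orbT // => ? ? [].
by rewrite mem_filter => /andP[/eqP yc yS]; rewrite mem_rcons inE yS orbT.
Qed.

(** * The greedy as a forward process *)

(** While [run] adds rings at the end of the list, this relation consumes them
    from its head, so that concrete executions can be followed step by step and
    in parallel with the recursion of [fail_prob_from]. *)
Inductive continues (ch : placement_rule R) I :
    assignment R -> seq R -> assignment R -> Prop :=
| continues_nil a : continues ch I a [::] a
| continues_place a x c s a' : admits d (observe I a x) c ->
    ch (observe I a x) c -> continues ch I (rcons a (x, c)) s a' ->
    continues ch I a (x :: s) a'
| continues_skip a x s a' : (forall c, ~ admits d (observe I a x) c) ->
    continues ch I a s a' -> continues ch I a (x :: s) a'.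

Lemma continues_rcons_place ch I a0 s a x c : continues ch I a0 s a ->
  admits d (observe I a x) c -> ch (observe I a x) c ->
  continues ch I a0 (rcons s x) (rcons a (x, c)).
Proof.
move=> cs; elim: cs => {a0 s a} [a|a y c' s a' ad cc _ IH|a y s a' na _ IH] A C /=.
- by apply: (continues_place A C); apply: continues_nil.
- by apply: (continues_place ad cc); apply: IH.
- by apply: (continues_skip na); apply: IH.
Qed.

Lemma continues_rcons_skip ch I a0 s a x : continues ch I a0 s a ->
  (forall c, ~ admits d (observe I a x) c) ->
  continues ch I a0 (rcons s x) a.
Proof.
move=> cs; elim: cs => {a0 s a} [a|a y c' s a' ad cc _ IH|a y s a' na _ IH] A /=.
- by apply: (continues_skip A); apply: continues_nil.
- by apply: (continues_place ad cc); apply: IH.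
- by apply: (continues_skip na); apply: IH.
Qed.

Lemma run_continues ch I s a : run d ch I s a <-> continues ch I [::] s a.
Proof.
split.
  elim=> {s a} [|s a x c _ IH A C|s a x _ IH A]; first exact: continues_nil.
    exact: continues_rcons_place.
  exact: continues_rcons_skip.
suff gen a0 s0 : run d ch I s0 a0 -> continues ch I a0 s a -> run d ch I (s0 ++ s) a.
  by move=> cs; apply: (gen [::] [::]) => //; apply: run_start.
move=> r cs; elim: cs s0 r => {a0 s a}
    [a|a y c' s a' ad cc _ IH|a y s a' na _ IH] s0 r.
- by rewrite cats0.
- by rewrite -cat_rcons; apply: IH; apply: run_place.
- by rewrite -cat_rcons; apply: IH; apply: run_skip.
Qed.

(** The condition on a rule that makes every execution run to its end. *)
Definition serial (ch : placement_rule R) : Prop :=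
  forall st, (exists c, admits d st c) -> exists2 c, admits d st c & ch st c.

Lemma continues_exists ch I a s : serial ch -> exists a', continues ch I a s a'.
Proof.
move=> ser; elim: s a => [|x s IH] a; first by exists a; apply: continues_nil.
have [ex|nex] := pselect (exists c, admits d (observe I a x) c).
  have [c ad cc] := ser _ ex; have [a' h] := IH (rcons a (x, c)).
  by exists a'; apply: continues_place h.
have [a' h] := IH a; exists a'; apply: continues_skip h => c ad.
by apply: nex; exists c.
Qed.

Lemma unrestricted_serial : serial (@unrestricted R).
Proof. by move=> st [c ad]; exists c. Qed.

Lemma admits_argmin (st : state R) (F : container R -> R) :
  (exists c, admits d st c) ->
  exists2 c, admits d st c & forall c', admits d st c' -> F c <= F c'.
Proof.
move=> [c0 ad0].
have gen (l : seq (container R)) : (exists2 c, c \in l & admits d st c) ->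
    exists2 c, admits d st c &
      forall c', c' \in l -> admits d st c' -> F c <= F c'.
  elim: l => [[]//|c l IH] _.
  have [[c1 ad1 min1]|none] := pselect (exists2 c, admits d st c &
      forall c', c' \in l -> admits d st c' -> F c <= F c'); last first.
    have no c' : c' \in l -> ~ admits d st c'.
      by move=> cl ad; apply: none; apply: IH; exists c'.
    have [ad|nad] := pselect (admits d st c).
      exists c => // c'; rewrite inE => /orP[/eqP ->//|cl ad'].
      by case: (no _ cl).
    by exists c0 => // c'; rewrite inE => /orP[/eqP ->//|cl ad'];
      case: (no _ cl).
  have [/andP[/asboolP ad cc]|] := boolP (`[< admits d st c >] && (F c <= F c1)).
    exists c => // c'; rewrite inE => /orP[/eqP ->//|cl ad'].
    by rewrite (le_trans cc) // min1.
  rewrite negb_and => h; exists c1 => // c'.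
  rewrite inE => /orP[/eqP -> ad|]; last exact: min1.
  by move: h => /orP[/asboolP//|]; rewrite -ltNge => /ltW.
have [c ad cmin] := gen _ (ex_intro2 _ _ c0 ad0.1 ad0).
by exists c => // c' ad'; apply: cmin => //; exact: ad'.1.
Qed.

Lemma best_fit_serial : serial (best_fit d).
Proof. by move=> st /(admits_argmin (st_capacity st))[c ad cmin]; exists c. Qed.

Lemma worst_fit_serial : serial (worst_fit d).
Proof.
move=> st /(admits_argmin (fun c => - st_capacity st c))[c ad cmin]; exists c => //.
by move=> c' /cmin; rewrite lerN2.
Qed.

Lemma follow_serial f : deterministic_rule d f -> serial (follow f).
Proof. by move=> df st /df ad; exists (f st). Qed.

Lemma continues_weaken ch I a s a' :
  continues ch I a s a' -> continues (@unrestricted R) I a s a'.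
Proof.
elim=> {a s a'} [a|a x c s a' ad _ _ IH|a x s a' na _ IH].
- exact: continues_nil.
- exact: continues_place IH.
- exact: continues_skip IH.
Qed.

(** * Greedy placements are feasible *)

Definition parent (a : assignment R) (x : R) : container R :=
  nth None (map snd a) (index x (placed a)).

Definition occupants (a : assignment R) (c : container R) : seq R :=
  [seq b.1 | b <- a & b.2 == c].

Lemma parentP a x c : uniq (placed a) ->
  (x, c) \in a <-> x \in placed a /\ parent a x = c.
Proof.
move=> ua; split=> [xca|[xa <-]].
  have xa : x \in placed a by apply/mapP; exists (x, c).
  split=> //; rewrite /parent.
  have [i ia iE] : exists2 i, (i < size a)%N & nth (x, c) a i = (x, c).
    by exists (index (x, c) a); rewrite ?index_mem ?nth_index.
  have xi : nth x (placed a) i = x by rewrite (nth_map (x, c)) // iE.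
  rewrite -{1}xi index_uniq ?size_map //.
  by rewrite (nth_map (x, c)) // iE.
have lt : (index x (placed a) < size a)%N by rewrite -(size_map fst) index_mem.
rewrite /parent (nth_map (x, None)) //.
have e : (nth (x, None) a (index x (placed a))).1 = x.
  by rewrite -(nth_map _ x) // nth_index.
rewrite -[X in (X, _)]e -surjective_pairing; exact: mem_nth.
Qed.

Lemma mem_occupants a c x : (x \in occupants a c) = ((x, c) \in a).
Proof.
apply/mapP/idP => [[[y c'] /=]|xca].
  by rewrite mem_filter => /andP[/eqP /= -> ya] ->.
by exists (x, c); rewrite // mem_filter eqxx.
Qed.

Lemma occupants_uniq a c : uniq (placed a) -> uniq (occupants a c).
Proof. by apply: subseq_uniq; apply: map_subseq; exact: filter_subseq. Qed.

(** Holds whenever a greedy processes [x], as the radii decrease; it makes the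
    radii in every container distinct and positive, as [packableP] requires. *)
Definition fresh a x : Prop :=
  [/\ uniq (placed a), all (fun y => 0 < y) (placed a), 0 < x &
      all (fun y => x < y) (placed a)].

Lemma fresh_notin a x : fresh a x -> x \notin placed a.
Proof. by case=> _ _ _ /allP xa; apply/negP => /xa; rewrite ltxx. Qed.

Lemma admitsP I a x c : fresh a x ->
  admits d (observe I a x) c <->
  c \in containers (placed a) /\
  packs d (capacity I c) (rcons (occupants a c) x).
Proof.
move=> fr; have xa := fresh_notin fr; case: fr => ua /allP a0 x0 _.
have occ y : y \in occupants a c -> y \in placed a.
  by rewrite mem_occupants => yc; apply/mapP; exists (y, c).
rewrite /admits /= packableP //.
  rewrite all_rcons x0; apply/allP => y /occ; exact: a0.
by rewrite rcons_uniq occupants_uniq // andbT; apply: contra xa => /occ.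
Qed.

Lemma placed_rcons a x c : placed (rcons a (x, c)) = rcons (placed a) x.
Proof. by rewrite /placed map_rcons. Qed.

Lemma fresh_uniq a x c : fresh a x -> uniq (placed (rcons a (x, c))).
Proof.
by move=> fr; rewrite placed_rcons rcons_uniq fresh_notin //; case: fr.
Qed.

Lemma placement_step I a x c : fresh a x -> placement I (placed a) (parent a) ->
  admits d (observe I a x) c ->
  placement I (placed (rcons a (x, c))) (parent (rcons a (x, c))).
Proof.
move=> fr pl /(admitsP I c fr)[cin pk].
have u' := fresh_uniq c fr; have xa := fresh_notin fr.
have [ua _ x0 _] := fr.
have memE y c' : ((y, c') \in rcons a (x, c)) =
    ((y == x) && (c' == c)) || ((y, c') \in a).
  by rewrite mem_rcons inE xpair_eqE.
have inS y : y \in placed a -> y \in placed (rcons a (x, c)).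
  by rewrite placed_rcons mem_rcons inE => ->; rewrite orbT.
split=> [y z yS /(conj yS)/(parentP _ _ u')|c' c'in].
  rewrite memE => /orP[/andP[/eqP -> /eqP zc]|/(parentP _ _ ua)[ya yz]].
    move: cin pk; rewrite -zc mem_hole => zin pk; split.
      by rewrite placed_rcons mem_rcons inE zin orbT.
    apply/hole1 => //; apply: packs_sub pk => u; rewrite inE => /eqP ->.
    by rewrite mem_rcons mem_head.
  have [zin le] := pl.1 _ _ ya yz; split=> //; exact: inS.
have filtE y : y \in [seq y <- placed (rcons a (x, c)) |
    parent (rcons a (x, c)) y == c'] -> ((y == x) && (c' == c)) || ((y, c') \in a).
  rewrite mem_filter => /andP[/eqP pc yS]; rewrite -memE; exact/parentP.
have [c'c|c'c] := eqVneq c' c.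
  rewrite -c'c in pk; apply: packs_sub pk => y /filtE.
  by rewrite c'c eqxx andbT mem_rcons inE mem_occupants.
have {}filtE y : y \in [seq y <- placed (rcons a (x, c)) |
    parent (rcons a (x, c)) y == c'] -> (y, c') \in a.
  by move=> /filtE; rewrite (negbTE c'c) andbF.
have [c'a|c'a] := boolP (c' \in containers (placed a)).
  by apply: (placement_packs pl c'a) => y /filtE /(parentP _ _ ua).
have no y : (y, c') \in a -> False.
  move=> yc; have [ya ye] := (parentP y c' ua).1 yc; move: c'a.
  by case: (c') ye => [z yz|//]; rewrite mem_hole (pl.1 _ _ ya yz).1.
by apply: (packs_sub (s := [::])) => [y /filtE/no//|]; exists (fun=> 0).
Qed.

End Placement.

(** * The lex-max set and stuck executions *)

Section Stuck.
Variables (R : realType) (d : nat) (hd : (2 <= d)%N) (I : instance R).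
Hypothesis w0 : 0 < width I.
Implicit Types (S s : seq R) (a : assignment R).

Definition inventory s : Prop :=
  all (fun x => 0 < x) s /\ sorted (fun x y => y < x) s.

Lemma gt_trans : transitive (fun x y : R => y < x).
Proof. by move=> y x z xy yz; apply: lt_trans yz xy. Qed.

Lemma inventory_uniq s : inventory s -> uniq s.
Proof.
by case=> _; apply: sorted_uniq; [exact: gt_trans | move=> x; rewrite /= ltxx].
Qed.

Lemma inventory_rcons s x : inventory (rcons s x) <->
  [/\ inventory s, 0 < x & all (fun y => x < y) s].
Proof.
rewrite /inventory all_rcons !(sorted_pairwise gt_trans) -cats1 pairwise_cat /=.
rewrite allrel1r andbT; split.
  by move=> [/andP[x0 s0] /andP[xs ps]].
by move=> [[s0 ps] x0 xs]; rewrite s0 x0 xs ps.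
Qed.

Lemma inventory_subseq s s' : subseq s s' -> inventory s' -> inventory s.
Proof.
move=> ss [s0 so]; split; last exact: (subseq_sorted gt_trans ss).
by apply/allP => x /(mem_subseq ss); apply/allP.
Qed.

Lemma inventory_fresh a x : inventory (rcons (placed a) x) -> fresh a x.
Proof.
by move=> /inventory_rcons[inv x0 xa]; split=> //; [exact: inventory_uniq|case: inv].
Qed.

Lemma inventory_feasible s : inventory s ->
  feasible d I s <-> exists par, placement d I s par.
Proof. by move=> inv; apply: feasibleP => //; [case: inv|exact: inventory_uniq]. Qed.

Lemma run_placement ch s a : inventory s -> run d ch I s a ->
  subseq (placed a) s /\ placement d I (placed a) (parent a).
Proof.
move=> + r; elim: r => {s a} [_|s a x c _ IH ad _|s a x _ IH _].
- split=> //; split=> // c _; by exists (fun=> 0).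
- move=> /inventory_rcons[inv x0 xs]; have [ss pl] := IH inv.
  split; first by rewrite placed_rcons -!cats1 cat_subseq.
  apply: placement_step => //; apply: inventory_fresh; apply/inventory_rcons.
  split=> //; first exact: inventory_subseq inv.
  by apply/allP => y /(mem_subseq ss); apply/allP.
- move=> /inventory_rcons[inv x0 xs]; have [ss pl] := IH inv; split=> //.
  by rewrite (subseq_trans ss) // subseq_rcons.
Qed.

Definition lex s : seq R :=
  foldl (fun S x => if `[< feasible d I (rcons S x) >] then rcons S x else S)
        [::] s.

Lemma lex_feasible s : inventory s -> feasible d I s -> lex s = s.
Proof.
elim/last_ind: s => // s x IH inv.
have [invs x0 xs] := (inventory_rcons _ _).1 inv.
move=> fe; rewrite /lex foldl_rcons -/(lex s).
rewrite IH //; first by rewrite asboolT.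
apply/inventory_feasible => //.
have [par pl] := (inventory_feasible inv).1 fe.
by exists par; apply: placement_prefix pl.
Qed.

(** The greedy has to skip [x], although [x] could be placed after a
    rearrangement of the rings placed so far. *)
Definition stuck a x : Prop :=
  [/\ inventory (rcons (placed a) x), placement d I (placed a) (parent a),
      forall c, ~ admits d (observe I a x) c &
      feasible d I (rcons (placed a) x)].

(** Since greedy placements are feasible, an execution can only deviate from
    the scan defining the lex-max set by skipping too much. *)
Lemma run_lex_or_stuck s a : inventory s -> run d (@unrestricted R) I s a ->
  placed a = lex s \/
  exists s1 x s2 a1, s = s1 ++ x :: s2 /\ subseq (placed a1) s1 /\ stuck a1 x.
Proof.
move=> + r; elim: r => {s a} [_|s a x c r IH ad _|s a x r IH na]; first by left.
all: move=> inv; have [invs x0 xs] := (inventory_rcons _ _).1 inv.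
all: have [ss pl] := run_placement invs r.
all: have invx : inventory (rcons (placed a) x) by apply/inventory_rcons; split=> //;
  [exact: inventory_subseq invs | apply/allP => y /(mem_subseq ss); apply/allP].
all: case: (IH invs) => [eqs|[s1 [y [s2 [a1 [-> st]]]]]]; last first.
- by right; exists s1, y, (rcons s2 x), a1; rewrite rcons_cat.
- left; rewrite placed_rcons /lex foldl_rcons -/(lex s) -eqs asboolT //.
  apply/inventory_feasible => //; rewrite -(placed_rcons a x c); eexists.
  by apply: placement_step => //; exact: inventory_fresh.
- by right; exists s1, y, (rcons s2 x), a1; rewrite rcons_cat.
- have [fe|nfe] := pselect (feasible d I (rcons (placed a) x)).
    by right; exists s, x, [::], a; rewrite cats1.
  by left; rewrite /lex foldl_rcons -/(lex s) -eqs asboolF.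
Qed.

(** The form in which stuck executions are refuted: two placements, and no
    container into which [x] could be added. *)
Lemma stuck_placements a x : stuck a x -> exists g h,
  [/\ placement d I (placed a) g, placement d I (rcons (placed a) x) h &
    forall c s, c \in containers (placed a) ->
      (forall y, y \in placed a -> g y = c -> y \in s) -> x \in s ->
      ~ packs d (capacity I c) s].
Proof.
move=> [inv pl na fe]; have [h hp] := (inventory_feasible inv).1 fe.
exists (parent a), h; split=> // c s cin gs xs pk; apply: (na c).
have fr := inventory_fresh inv.
apply/admitsP => //; split=> //; apply: packs_sub pk => y.
rewrite mem_rcons inE => /orP[/eqP ->//|].
rewrite mem_occupants => /(parentP _ _ _)[]; first by case: fr.
exact: gs.
Qed.

(** Exchange argument. When every ring is at least the sum of all smaller ones,
    any placement of the same rings together with [x] can be turned into one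
    that agrees with the greedy: the largest ring [y] placed differently moves
    to the container chosen by the greedy, and the smaller rings found there
    take the place it leaves, since they fit in a row inside [y]. *)
Lemma superincreasing_not_stuck (s : seq R) a x :
  (forall y, y \in s -> \sum_(z <- s | z < y) z <= y) ->
  all (fun z => 0 < z) s ->
  subseq (rcons (placed a) x) s -> ~ stuck a x.
Proof.
move=> superinc s0 sub st.
have [g [h0 [gp hp0 nopack]]] := stuck_placements st.
case: st => inv _ _ _; set S := placed a in inv sub gp hp0 nopack *.
have [invS x0 /allP xS] := (inventory_rcons _ _).1 inv.
have agree S1 S2 : S = S1 ++ S2 -> exists2 h,
    placement d I (rcons S x) h & {in S1, g =1 h}.
  elim/last_ind: S1 S2 => [|S1 y IH] S2 SE; first by exists h0.
  have {}SE : S = S1 ++ y :: S2 by rewrite -cat_rcons.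
  have [h hp gh] := IH _ SE.
  have [hy|hy] := eqVneq (h y) (g y).
    by exists h => // z; rewrite mem_rcons inE => /orP[/eqP ->|/gh].
  have yS : y \in S by rewrite SE mem_cat mem_head orbT.
  have ySx : y \in rcons S x by rewrite mem_rcons inE yS orbT.
  have big z : z \in rcons S x -> y < z -> z \in S1.
    rewrite mem_rcons inE => /orP[/eqP ->|]; first by have := xS _ yS; lra.
    rewrite {1}SE mem_cat inE => /or3P[//|/eqP ->|zS2]; first by rewrite ltxx.
    have : pairwise (fun u v => v < u) S by rewrite -(sorted_pairwise gt_trans); case: invS.
    rewrite SE pairwise_cat /= => /and4P[_ _ /allP/(_ _ zS2) zy _]; lra.
  pose h' z := if z == y then g y else
               if (h z == g y) && (z < y) then h y else h z.
  have S1y z : z \in S1 -> y < z.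
    have : pairwise (fun u v => v < u) S by rewrite -(sorted_pairwise gt_trans); case: invS.
    rewrite SE pairwise_cat => /and3P[/allrelP al _ _] zS1.
    by apply: al => //; rewrite mem_head.
  exists h'; last first.
    move=> z; rewrite mem_rcons inE => /orP[/eqP ->|zS1].
      by rewrite /h' eqxx.
    have zy := S1y _ zS1.
    by rewrite /h' gt_eqF // gh // (ltNge z) (ltW zy) andbF.
  have gyin : g y \in containers S.
    by case E: (g y) => [u|//]; rewrite mem_hole; case: (gp.1 _ _ yS E).
  split=> [z u zS|c cin].
    rewrite /h'; case: eqP => [->|_].
      move=> E; have [uS le] := gp.1 _ _ yS E; split=> //.
      by rewrite mem_rcons inE uS orbT.
    case: ifP => [/andP[_ zy] E|_ E]; last exact: hp.1.
    by have [uS le] := hp.1 _ _ ySx E; split=> //; lra.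
  have [cA|cA] := eqVneq c (g y).
    rewrite cA; apply: (placement_packs gp gyin) => z.
    rewrite mem_filter /h' => /andP[+ zSx].
    case: (eqVneq z y) => [->//|zy].
    case: (boolP (_ && _)) => [_|]; first by rewrite (negbTE hy).
    rewrite negb_and => /orP[/negbTE -> //|nzy /eqP hz].
    have yz : y < z by rewrite lt_neqAle eq_sym zy leNgt.
    have zS1 := big _ zSx yz; split; last by rewrite gh.
    by rewrite SE mem_cat zS1.
  have [cB|cB] := eqVneq c (h y); last first.
    apply: (placement_packs hp cin) => z; rewrite mem_filter /h'.
    case: (eqVneq z y) => [_|zy]; first by rewrite eq_sym (negbTE cA).
    case: ifP => [_|_]; first by rewrite eq_sym (negbTE cB).
    by move=> /andP[/eqP].
  pose P z := [&& z \in rcons S x, h z == g y & z < y].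
  have := hp.2 c cin.
  apply: (packs_subst hd (L := [seq z <- s | P z]) (y := y)).
  - by apply/allP => z; rewrite mem_filter => /andP[_]; apply/allP.
  - rewrite big_filter; apply: le_trans (superinc y _); last exact: (mem_subseq sub).
    rewrite big_mkcond [leRHS]big_mkcond /= big_seq [leRHS]big_seq.
    apply: ler_sum => z zs; rewrite /P; case: (z < y); rewrite ?andbF // andbT.
    by case: ifP => // _; rewrite ltW // (allP s0).
  - by rewrite mem_filter -cB eqxx ySx.
  - move=> z; rewrite !mem_filter /h' => /andP[+ zSx].
    case: (eqVneq z y) => [_|zy]; first by rewrite eq_sym (negbTE cA).
    case: (boolP (_ && _)) => [/andP[hz zly] _|_ hz]; last by right; rewrite hz zSx.
    by left; rewrite /P zSx hz zly (mem_subseq sub).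
have [h hp gh] := agree S [::] (esym (cats0 S)).
have xSx : x \in rcons S x by rewrite mem_rcons mem_head.
have hxin : h x \in containers S.
  case E: (h x) => [u|//]; have [] := hp.1 _ _ xSx E.
  by rewrite mem_hole mem_rcons inE => /orP[/eqP ->|//]; rewrite lerDl oppr_ge0 leNgt w0.
have sub' y : y \in S -> g y = h x -> y \in [seq z <- rcons S x | h z == h x].
  by move=> yS gy; rewrite mem_filter -(gh _ yS) gy eqxx mem_rcons inE yS orbT.
have xin : x \in [seq z <- rcons S x | h z == h x] by rewrite mem_filter eqxx.
have hxin' : h x \in containers (rcons S x).
  by case: (h x) hxin => [u|//]; rewrite !mem_hole mem_rcons inE => ->; rewrite orbT.
exact: (nopack _ _ hxin sub' xin (hp.2 _ hxin')).
Qed.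

End Stuck.

(** * Stuck executions with at most two placed rings *)

Section FewRings.
Variables (R : realType) (d : nat) (hd : (2 <= d)%N) (I : instance R).
Hypothesis w0 : 0 < width I.
Implicit Types (S s : seq R) (a : assignment R) (x y z : R).

Lemma placement_parent S par x y : placement d I S par -> x \in S ->
  par x = Some y -> [/\ y \in S, x <= y - width I & x < y].
Proof.
move=> pl xS /(pl.1 _ _ xS)[yS xy]; split=> //.
by apply: le_lt_trans xy _; rewrite gtrDl oppr_lt0.
Qed.

Lemma placement_pan2 S par x y : placement d I S par -> x \in S -> y \in S ->
  0 < x -> 0 < y -> x != y -> par x = None -> par y = None -> x + y <= pan I.
Proof.
move=> pl xS yS x0 y0 xy px py; apply/(packs2 hd) => //.
by apply: (placement_packs pl (c := None)) => // z; rewrite !inE => /orP[]/eqP ->.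
Qed.

Lemma placement_hole2 S par x y z : placement d I S par -> x \in S -> y \in S ->
  0 < x -> 0 < y -> x != y -> par x = Some z -> par y = Some z ->
  x + y <= z - width I.
Proof.
move=> pl xS yS x0 y0 xy px py; apply/(@hole2 _ d hd) => //.
have [zS _ _] := placement_parent pl xS px.
apply: (placement_packs pl (c := Some z)); first by rewrite mem_hole.
by move=> u; rewrite !inE => /orP[]/eqP ->.
Qed.

Lemma placement_packs3 S par c x y z : placement d I S par ->
  c \in containers S -> x \in S -> y \in S -> z \in S ->
  par x = c -> par y = c -> par z = c -> packs d (capacity I c) [:: x; y; z].
Proof.
move=> pl cS xS yS zS px py pz; apply: (placement_packs pl cS) => u.
by rewrite !inE => /or3P[] /eqP ->.
Qed.

Lemma stuck_nonempty x : ~ stuck d I [::] x.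
Proof.
move=> st; have [g [h [_ hp nopack]]] := stuck_placements hd st.
have hx : h x = None.
  case E: (h x) => [y|//]; have xS : x \in rcons [::] x by rewrite inE.
  by have [] := placement_parent hp xS E; rewrite inE => /eqP -> _; rewrite ltxx.
apply: (nopack None [:: x]) => //; first by rewrite inE.
by apply: (placement_packs hp (c := None)) => // u; rewrite !inE => /eqP ->.
Qed.

Lemma stuck1 p x a : placed a = [:: p] -> ~ stuck d I a x.
Proof.
move=> pa st; have [g [h]] := stuck_placements hd st.
case: st; rewrite pa => inv _ _ _ [gp hp nopack]; clear pa.
have [[/= /andP[p0 /andP[x0 _]] /andP[xp _]]] := inv.
have pS : p \in rcons [:: p] x by rewrite !inE eqxx.
have xS : x \in rcons [:: p] x by rewrite !inE eqxx orbT.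
have gpan : g p = None.
  case E: (g p) => [y|//]; have [] := placement_parent gp (mem_head _ _) E.
  by rewrite inE => /eqP -> _; rewrite ltxx.
have hpan : h p = None.
  case E: (h p) => [y|//]; have [] := placement_parent hp pS E.
  by rewrite !inE => /orP[] /eqP -> _ ?; exfalso; lra.
case E: (h x) => [y|].
  have [] := placement_parent hp xS E.
  rewrite !inE => /orP[]/eqP -> xy ylt; last by rewrite ltxx in ylt.
  apply: (nopack (Some p) [:: x]); rewrite ?mem_hole // ?inE //.
    by move=> u; rewrite inE => /eqP ->; rewrite gpan.
  exact/hole1.
apply: (nopack None [:: p; x]); rewrite ?inE ?eqxx ?orbT //.
  by move=> u; rewrite !inE => ->.
by apply: (placement_packs hp) => // u; rewrite !inE => /orP[] /eqP ->; rewrite ?eqxx ?orbT.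
Qed.

Lemma stuck2 p q x a : placed a = [:: p; q] -> ~ stuck d I a x.
Proof.
move=> pa st; have [g [h]] := stuck_placements hd st.
case: st; rewrite pa => inv _ _ _ [gp hp nopack]; clear pa.
have [[/= /and4P[p0 q0 x0 _] /and3P[qp xq _]]] := inv.
have xp : x < p by lra.
have nqp : p != q by rewrite gt_eqF.
have nqx : q != x by rewrite gt_eqF.
have npx : p != x by rewrite gt_eqF.
have pS : p \in rcons [:: p; q] x by rewrite !inE eqxx.
have qS : q \in rcons [:: p; q] x by rewrite !inE eqxx orbT.
have xS : x \in rcons [:: p; q] x by rewrite !inE eqxx !orbT.
have gpan : g p = None.
  case E: (g p) => [y|//]; have [] := placement_parent gp (mem_head _ _) E.
  by rewrite !inE => /orP[] /eqP -> _ ?; exfalso; lra.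
have hpan : h p = None.
  case E: (h p) => [y|//]; have [] := placement_parent hp pS E.
  by rewrite !inE => /or3P[] /eqP -> _ ?; exfalso; lra.
have qS' : q \in [:: p; q] by rewrite !inE eqxx orbT.
have hq : h q = None \/ h q = Some p.
  case E: (h q) => [y|]; [right|by left]; have [] := placement_parent hp qS E.
  by rewrite !inE => /or3P[] /eqP -> // *; exfalso; lra.
have hx : [\/ h x = None, h x = Some p | h x = Some q].
  case E: (h x) => [y|]; last by constructor 1.
  have [] := placement_parent hp xS E; rewrite !inE.
  by move=> /or3P[] /eqP -> *; [constructor 2|constructor 3|exfalso; lra].
have hole_q : q - width I < x.
  rewrite ltNge; apply/negP => /(@hole1 _ d _ _ _ x0) pk.
  apply: (nopack (Some q) [:: x]); rewrite ?mem_hole // ?inE ?eqxx ?orbT //.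
  move=> u; rewrite !inE => /orP[]/eqP ->; first by rewrite gpan.
  by move=> E; have [_ _] := placement_parent gp qS' E; rewrite ltxx.
have nhxq : h x <> Some q.
  by move=> E; have [_ ? _] := placement_parent hp xS E; lra.
have no_pan (l : seq R) : (forall u, u \in [:: p; q] -> g u = None -> u \in l) -> x \in l ->
  ~ (forall u, u \in l -> u \in rcons [:: p; q] x /\ h u = None).
  move=> h1 h2 h3; apply: (nopack None l) => //.
  exact: (placement_packs hp).
case gq: (g q) => [y|].
  have yp : y = p.
    have [] := placement_parent gp qS' gq.
    by rewrite !inE => /orP[]/eqP ->; rewrite ?ltxx.
  subst y.
  have over : pan I < p + x.
    rewrite ltNge; apply/negP => /(packs2 hd _ p0 x0 npx) pk.
    apply: (nopack None [:: p; x]); rewrite ?inE ?eqxx ?orbT //.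
    by move=> u; rewrite !inE => /orP[]/eqP ->; rewrite ?eqxx // gq.
  have over2 : p - width I < q + x.
    rewrite ltNge; apply/negP => /(@hole2 _ d hd _ _ _ _ q0 x0 nqx) pk.
    apply: (nopack (Some p) [:: q; x]); rewrite ?mem_hole // ?inE ?eqxx ?orbT //.
    by move=> u; rewrite !inE => /orP[]/eqP ->; rewrite ?eqxx // gpan.
  case: hx => // [hx|hx].
    by move: (placement_pan2 hp pS xS p0 x0 npx hpan hx) => *; lra.
  case: hq => hq.
    by move: (placement_pan2 hp pS qS p0 q0 nqp hpan hq) => *; lra.
  by move: (placement_hole2 hp qS xS q0 x0 nqx hq hx) => *; lra.
have hole_p : p - width I < x.
  rewrite ltNge; apply/negP => /(@hole1 _ d _ _ _ x0) pk.
  apply: (nopack (Some p) [:: x]); rewrite ?mem_hole // ?inE ?eqxx //.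
  by move=> u; rewrite !inE => /orP[]/eqP ->; rewrite ?gpan ?gq.
case: hq => hq; last by have [_ ? _] := placement_parent hp qS hq; lra.
case: hx => // hx; last by have [_ ? _] := placement_parent hp xS hx; lra.
apply: (no_pan [:: p; q; x]); rewrite ?inE ?eqxx ?orbT //.
  by move=> u; rewrite !inE => /orP[] ->; rewrite ?orbT.
by move=> u; rewrite !inE => /or3P[] /eqP ->; rewrite ?eqxx ?orbT.
Qed.

(** * Stuck executions with three placed rings *)

Lemma lt_le_contra (u v z : R) : u < v -> v <= z -> z <= u -> False.
Proof. by move=> uv vz zu; have := lt_le_trans uv (le_trans vz zu); rewrite ltxx. Qed.

Section ThreeRings.
Variables (p q r x : R) (g h : R -> container R).
Hypotheses (x0 : 0 < x) (xr : x < r) (rq : r < q) (qp : q < p).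
Let S := [:: p; q; r].
Hypotheses (gp : placement d I S g) (hp : placement d I (rcons S x) h).
Hypothesis nopack : forall c s, c \in containers S ->
  (forall y, y \in S -> g y = c -> y \in s) -> x \in s ->
  ~ packs d (capacity I c) s.
Hypothesis fits : packs d (p + q) [:: p; q; x].

Let r0 : 0 < r. Proof. exact: lt_trans xr. Qed.
Let q0 : 0 < q. Proof. exact: lt_trans rq. Qed.
Let p0 : 0 < p. Proof. exact: lt_trans qp. Qed.
Let xq : x < q. Proof. exact: lt_trans rq. Qed.
Let rp : r < p. Proof. exact: lt_trans qp. Qed.
Let xp : x < p. Proof. exact: lt_trans qp. Qed.
Let npq : p != q. Proof. by rewrite gt_eqF. Qed.
Let npr : p != r. Proof. by rewrite gt_eqF. Qed.
Let npx : p != x. Proof. by rewrite gt_eqF. Qed.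
Let nqr : q != r. Proof. by rewrite gt_eqF. Qed.
Let nqx : q != x. Proof. by rewrite gt_eqF. Qed.
Let nrx : r != x. Proof. by rewrite gt_eqF. Qed.
Let pS : p \in rcons S x. Proof. by rewrite !inE eqxx. Qed.
Let qS : q \in rcons S x. Proof. by rewrite !inE eqxx orbT. Qed.
Let rS : r \in rcons S x. Proof. by rewrite !inE eqxx !orbT. Qed.
Let xS : x \in rcons S x. Proof. by rewrite !inE eqxx !orbT. Qed.
Let pS' : p \in S. Proof. by rewrite !inE eqxx. Qed.
Let qS' : q \in S. Proof. by rewrite !inE eqxx orbT. Qed.
Let rS' : r \in S. Proof. by rewrite !inE eqxx !orbT. Qed.
Let pxq : p + x <= p + q. Proof. by rewrite lerD2l ltW. Qed.
Let pxr : p + x <= p + r. Proof. by rewrite lerD2l ltW. Qed.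
Let qxr : q + x <= q + r. Proof. by rewrite lerD2l ltW. Qed.
Let spq : Some p <> Some q.
Proof. by case=> /eqP; rewrite (negbTE npq). Qed.

Let mem_par par T u y : placement d I T par -> u \in T -> par u = Some y ->
  y \in T /\ u < y.
Proof. by move=> pl uT /(placement_parent pl uT)[]. Qed.

Let gpan : g p = None.
Proof.
case E: (g p) => [y|//]; have [] := mem_par gp pS' E.
by rewrite !inE => /or3P[] /eqP ->; rewrite ?ltxx // ltNge ltW.
Qed.

Let hpan : h p = None.
Proof.
case E: (h p) => [y|//]; have [] := mem_par hp pS E.
by rewrite !inE => /or4P[] /eqP ->; rewrite ?ltxx // ltNge ltW.
Qed.

Let gqP : g q = None \/ g q = Some p.
Proof.
case E: (g q) => [y|]; [right|by left]; have [] := mem_par gp qS' E.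
by rewrite !inE => /or3P[] /eqP -> //; rewrite ?ltxx // ltNge ltW.
Qed.

Let hqP : h q = None \/ h q = Some p.
Proof.
case E: (h q) => [y|]; [right|by left]; have [] := mem_par hp qS E.
by rewrite !inE => /or4P[] /eqP -> //; rewrite ?ltxx // ltNge ltW.
Qed.

Let grP : [\/ g r = None, g r = Some p | g r = Some q].
Proof.
case E: (g r) => [y|]; last by constructor 1.
have [] := mem_par gp rS' E; rewrite !inE.
by move=> /or3P[] /eqP -> lt; [constructor 2|constructor 3|rewrite ltxx in lt].
Qed.

Let hrP : [\/ h r = None, h r = Some p | h r = Some q].
Proof.
case E: (h r) => [y|]; last by constructor 1.
have [] := mem_par hp rS E; rewrite !inE => /or4P[] /eqP -> lt.
- by constructor 2.
- by constructor 3.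
- by rewrite ltxx in lt.
- by rewrite ltNge ltW in lt.
Qed.

Let hxP : [\/ h x = None, h x = Some p, h x = Some q | h x = Some r].
Proof.
case E: (h x) => [y|]; last by constructor 1.
have [] := mem_par hp xS E; rewrite !inE => /or4P[] /eqP -> lt.
- by constructor 2.
- by constructor 3.
- by constructor 4.
- by rewrite ltxx in lt.
Qed.

Let hsub u y : u \in rcons S x -> h u = Some y -> u <= y - width I.
Proof. by move=> uS /(placement_parent hp uS)[]. Qed.

Let nopan (l : seq R) : (g q = None -> q \in l) -> (g r = None -> r \in l) ->
  p \in l -> x \in l -> ~ packs d (pan I) l.
Proof.
move=> ql rl pl xl; apply: (nopack (c := None)) xl; first exact: mem_head.
move=> u; rewrite !inE => /or3P[] /eqP ->; [by move=> _|exact: ql|exact: rl].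
Qed.

Let empty y : y \in S -> g q <> Some y -> g r <> Some y -> y - width I < x.
Proof.
move=> yS gqy gry; rewrite ltNge; apply/negP => /(@hole1 _ d _ _ _ x0).
apply: (nopack (c := Some y)); rewrite ?mem_hole ?mem_head //.
by move=> u; rewrite !inE => /or3P[]/eqP ->; rewrite ?gpan.
Qed.

Let single y u : y \in S -> 0 < u -> u != x ->
  (g q = Some y -> q = u) -> (g r = Some y -> r = u) -> y - width I < u + x.
Proof.
move=> yS u0 ux gqy gry; rewrite ltNge; apply/negP.
move=> /(@hole2 _ d hd _ _ _ _ u0 x0 ux).
apply: (nopack (c := Some y)); rewrite ?mem_hole // ?inE ?eqxx ?orbT //.
move=> v; rewrite !inE => /or3P[]/eqP ->; first by rewrite gpan.
  by move=> /gqy ->; rewrite eqxx.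
by move=> /gry ->; rewrite eqxx.
Qed.

Let alone : g r <> None -> pan I < p + x \/ g q = None.
Proof.
move=> gr; case E: (g q) => [y|]; [left|by right].
rewrite ltNge; apply/negP => /(packs2 hd _ p0 x0 npx).
by apply: nopan; rewrite ?E // !inE eqxx ?orbT.
Qed.

Let h_pan u : u \in rcons S x -> 0 < u -> p != u -> h u = None ->
  p + u <= pan I.
Proof.
by move=> uS u0 npu hu; apply: (placement_pan2 hp) pS uS p0 u0 npu hpan hu.
Qed.

Let h_qr : h q = Some p -> h r = Some p -> q + r <= p - width I.
Proof. exact: (placement_hole2 hp) qS rS q0 r0 nqr. Qed.

Let h_qx : h q = Some p -> h x = Some p -> q + x <= p - width I.
Proof. exact: (placement_hole2 hp) qS xS q0 x0 nqx. Qed.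

Let nhxr : h x <> Some r.
Proof.
move=> /(hsub xS) le; suff : r - width I < x by rewrite ltNge le.
apply: empty => [|/(mem_par gp qS')[_]|/(mem_par gp rS')[_]]; first exact: rS'.
  by rewrite ltNge ltW.
by rewrite ltxx.
Qed.

Let hole_q : g r <> Some q -> q - width I < x.
Proof.
move=> gr; apply: empty => [|/(mem_par gp qS')[_]|//]; first exact: qS'.
by rewrite ltxx.
Qed.

Let wide : p + q <= pan I -> packs d (pan I) [:: p; q; x].
Proof. by move=> le; apply: packs_le fits. Qed.

Lemma three_pan_pan : g q = None -> g r = None -> False.
Proof.
move=> gq gr; have ep : p - width I < x by apply: empty; rewrite ?gq ?gr.
have in_p u : u \in rcons S x -> x <= u -> h u = None.
  move=> uS xu; case E: (h u) => [y|//].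
  have [yS le _] := placement_parent hp uS E.
  have yp : y <= p by move: yS; rewrite !inE => /or4P[] /eqP ->; rewrite ?lexx ?ltW.
  by case: (lt_le_contra ep xu (le_trans le (lerB yp (lexx _)))).
apply: (nopan (l := [:: p; q; r; x])); try by rewrite !inE eqxx ?orbT.
have := hp.2 None (mem_head _ _).
by rewrite /= hpan (in_p _ qS (ltW xq)) (in_p _ rS (ltW xr)) (in_p _ xS (lexx x)).
Qed.

(** The other placement nests [q] and puts [r] and [x] in the pan. *)
Lemma three_pan_hole : g q = None -> g r = Some p -> False.
Proof.
move=> gq gr; apply: (nopan (l := [:: p; q; x]));
  try by rewrite ?gr // !inE eqxx ?orbT.
by apply: wide; apply: (placement_pan2 gp) pS' qS' p0 q0 npq gpan gq.
Qed.

Lemma three_pan_nested : g q = None -> g r = Some q -> False.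
Proof.
move=> gq gr; have ep : p - width I < x.
  by apply: empty => [|E|E]; [|rewrite gq in E|rewrite gr in E; case: spq].
have [_ le _] := placement_parent gp rS' gr.
exact: lt_le_contra ep (ltW xr) (le_trans le (lerB (ltW qp) (lexx _))).
Qed.

(** The other placement puts [q] in the pan and nests [r] and [x]. *)
Lemma three_hole_pan : g q = Some p -> g r = None -> False.
Proof.
move=> gq gr; have eq_ : q - width I < x by apply: hole_q; rewrite gr.
have over : p - width I < q + x by apply: single => //; rewrite gr.
have np : ~ packs d (pan I) [:: p; r; x].
  by apply: nopan; try by rewrite ?gq // !inE eqxx ?orbT.
case: hqP => hq.
  apply/np/(packs3_dom (lexx p) (ltW rq) (lexx x) npr npx nrx npq npx nqx).
  exact/wide/(h_pan qS q0 npq hq).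
case: hrP => hr; last exact: lt_le_contra eq_ (ltW xr) (hsub rS hr).
  case: hxP => hx; last exact: nhxr.
  - exact/np/(placement_packs3 hp (mem_head _ _) pS rS xS hpan hr hx).
  - exact: lt_le_contra over (lexx _) (h_qx hq hx).
  - exact: lt_le_contra eq_ (lexx x) (hsub xS hx).
exact: lt_le_contra over qxr (h_qr hq hr).
Qed.

Lemma three_hole_hole : g q = Some p -> g r = Some p -> False.
Proof.
move=> gq gr; have [over|] : pan I < p + x \/ g q = None by apply: alone; rewrite gr.
  have eq_ : q - width I < x by apply: hole_q; rewrite gr.
  case: hqP => hq; first exact: lt_le_contra over pxq (h_pan qS q0 npq hq).
  case: hrP => hr; first exact: lt_le_contra over pxr (h_pan rS r0 npr hr).
    case: hxP => hx; last exact: nhxr.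
    - exact: lt_le_contra over (lexx _) (h_pan xS x0 npx hx).
    - apply: (nopack (c := Some p) (s := [:: q; r; x])).
      + by rewrite mem_hole.
      + move=> u; rewrite !inE => /or3P[] /eqP ->; rewrite ?eqxx ?orbT //.
        by rewrite gpan.
      + by rewrite !inE eqxx !orbT.
      by apply: (placement_packs3 hp _ qS rS xS hq hr hx); rewrite mem_hole.
    - exact: lt_le_contra eq_ (lexx x) (hsub xS hx).
  exact: lt_le_contra eq_ (ltW xr) (hsub rS hr).
by rewrite gq.
Qed.

Lemma three_hole_nested : g q = Some p -> g r = Some q -> False.
Proof.
move=> gq gr; have [over|] : pan I < p + x \/ g q = None by apply: alone; rewrite gr.
  case: hqP => hq; first exact: lt_le_contra over pxq (h_pan qS q0 npq hq).
  have over_p : p - width I < q + x.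
    by apply: single => // E; case: spq; rewrite -gr E.
  have over_q : q - width I < r + x.
    by apply: single => // E; case: spq; rewrite -gq E.
  case: hrP => hr; first exact: lt_le_contra over pxr (h_pan rS r0 npr hr).
    exact: lt_le_contra over_p qxr (h_qr hq hr).
  case: hxP => hx; last exact: nhxr.
  - exact: lt_le_contra over (lexx _) (h_pan xS x0 npx hx).
  - exact: lt_le_contra over_p (lexx _) (h_qx hq hx).
  - exact: lt_le_contra over_q (lexx _) (placement_hole2 hp rS xS r0 x0 nrx hr hx).
by rewrite gq.
Qed.

Lemma three_rings : False.
Proof.
case: gqP => gq; case: grP => gr.
- exact: three_pan_pan.
- exact: three_pan_hole.
- exact: three_pan_nested.
- exact: three_hole_pan.
- exact: three_hole_hole.
- exact: three_hole_nested.
Qed.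

End ThreeRings.

(** There are two ways to be stuck with three placed rings: either the greedy
    put [q] in the pan and [r] in the hole of [p] where it should have been the
    other way round, or conversely. In both cases [p] and [q] fit side by side
    in the pan, but [x] does not fit beside them, not even in the smallest such
    pan. *)
Lemma stuck3 p q r x a : placed a = [:: p; q; r] -> stuck d I a x ->
  ~ packs d (p + q) [:: p; q; x].
Proof.
move=> pa st; have [g [h]] := stuck_placements hd st.
case: st; rewrite pa => inv _ _ _ [gp hp nopack].
have [[/= /and5P[p0 q0 r0 x0 _] /and4P[qp rq xr _]]] := inv.
exact: (three_rings x0 xr rq qp gp hp nopack).
Qed.

End FewRings.

(** * Bounds on the ratio *)

Section Ratio.
Variables (R : realType) (d : nat) (hd : (2 <= d)%N).
Implicit Types (I : instance R).

Lemma valid_inventory I : valid I -> inventory (rings I).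
Proof. by case. Qed.

Lemma tail_sum (s1 s2 : seq R) (x : R) (s := s1 ++ x :: s2) :
  \sum_(j < size s | (size s1 < j)%N) s`_j = \sum_(z <- s2) z.
Proof.
rewrite -(big_mkord (fun j => (size s1 < j)%N) (fun j => s`_j)).
rewrite -[LHS](big_nat_widenl (size s1).+1 0 (size s) xpredT) //.
rewrite -{1}[(size s1).+1]add0n big_addn [RHS](big_nth 0).
have -> : (size s - (size s1).+1 = size s2)%N.
  by rewrite /s size_cat /= addnS subSS addKn.
apply: eq_bigr => i _; rewrite /s nth_cat addnS ltnNge leqW ?leq_addl //=.
by rewrite subSn ?leq_addl // addnK.
Qed.

Lemma rho_ge (w N : R) (s1 s2 : seq R) (x : R) :
  (\sum_(z <- s2) z) / x <= rho (Instance w N (s1 ++ x :: s2)).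
Proof.
set s := s1 ++ x :: s2.
have lt : (size s1 < size s)%N by rewrite size_cat /= addnS ltnS leq_addr.
pose F (i : 'I_(size s)) := (\sum_(j < size s | (i < j)%N) s`_j) / s`_i.
rewrite -(tail_sum s1 s2 x) -/s.
have xE : s`_(Ordinal lt) = x by rewrite /s /= nth_cat ltnn subnn.
by rewrite -[X in _ / X]xE; exact: (le_bigmax 0 F (Ordinal lt)).
Qed.

Lemma rho_superincreasing I y : valid I -> rho I <= 1 -> y \in rings I ->
  \sum_(z <- rings I | z < y) z <= y.
Proof.
case: I => w N s [_ _ /= s0 so] rho1 ys.
have [s1 [s2 sE]] : exists s1 s2, s = s1 ++ y :: s2.
  by case/splitPr: ys => s1 s2; exists s1, s2.
have y0 : 0 < y := allP s0 _ ys.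
have := so; rewrite sE (sorted_pairwise (@gt_trans R)) pairwise_cat /=.
move=> /and4P[/allrelP gt1 _ /allP lt2 _].
rewrite big_cat big_cons ltxx /= big_seq_cond big_pred0 ?add0r; last first.
  move=> z; apply/negP => /andP[/gt1/(_ (mem_head _ _)) yz zy].
  by have := lt_trans yz zy; rewrite ltxx.
rewrite big_seq_cond (eq_bigl (fun z => z \in s2)) -?big_seq; last first.
  by move=> z; apply: andb_idr => /lt2.
have := rho_ge w N s1 s2 y; rewrite -sE => le.
by move: (le_trans le rho1); rewrite ler_pdivrMr // mul1r.
Qed.

Lemma rho4 (w N p q r x : R) : rho (Instance w N [:: p; q; r; x]) =
  Num.max ((q + r + x) / p) (Num.max ((r + x) / q) (Num.max (x / r) 0)).
Proof.
rewrite /rho /= !big_ord_recl big_ord0 /=.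
have t (s1 s2 : seq R) y := tail_sum s1 s2 y.
have := t [::] [:: q; r; x] p; have := t [:: p] [:: r; x] q.
have := t [:: p; q] [:: x] r; have := t [:: p; q; r] [::] x.
rewrite /= !big_cons !big_nil !addr0 => -> -> -> ->.
by rewrite mul0r maxxx addrA.
Qed.

Lemma failing_rho_gt1 I : failing d I -> 1 < rho I.
Proof.
move=> [vI [a [ex ne]]]; rewrite ltNge; apply/negP => rho1.
have [w0 _ s0 _] := vI.
have [//|[s1 [x [s2 [a1 [sE [sub st]]]]]]] :=
  run_lex_or_stuck hd (valid_inventory vI) ex.
apply: (@superincreasing_not_stuck _ _ hd _ w0 (rings I) a1 x _ s0) st.
  by move=> y yI; apply: rho_superincreasing.
rewrite sE -cats1; apply: cat_subseq => //.
by rewrite sub1seq mem_head.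
Qed.

(** The golden ratio appears as follows: a ball that does not fit beside [p]
    and [q] exceeds [p q (p + q) / (p^2 + p q + q^2)], hence so do [r] and
    [x]; if moreover [(r + x) / q <= phi], then [p / q < phi], whereas
    [(q + r + x) / p <= phi] gives [p / q > phi]. *)
Lemma golden_bound (phi p q r x : R) : phi ^+ 2 = phi + 1 -> 0 < phi ->
  0 < x -> x < r -> r < q -> q < p -> ~ packs d (p + q) [:: p; q; x] ->
  phi < (q + r + x) / p \/ phi < (r + x) / q.
Proof.
move=> phiE phi0 x0 xr rq qp np.
have p0 : 0 < p by lra.
have q0 : 0 < q by lra.
have big : p * q * (p + q) < x * (p ^+ 2 + p * q + q ^+ 2).
  rewrite ltNge; apply/negP => small; apply/np/packs3_diameter => //.
  by rewrite x0 /=; lra.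
rewrite !ltr_pdivlMr //.
have [|le1] := ltP (phi * p) (q + r + x); first by left.
have [|le2] := ltP (phi * q) (r + x); first by right.
have D0 : 0 < p ^+ 2 + p * q + q ^+ 2 by rewrite !addr_gt0 ?mulr_gt0 ?exprn_gt0.
have h1 : 0 < q * (phi * (p ^+ 2 + p * q + q ^+ 2) - 2 * p * (p + q)).
  have := ltr_pM2r D0 (2 * x) (phi * q); rewrite (_ : 2 * x < phi * q); last by lra.
  by move: big; lra.
have h2 : 0 < (phi * p - q) * (p ^+ 2 + p * q + q ^+ 2) - 2 * p * q * (p + q).
  have := ltr_pM2r D0 (2 * x) (phi * p - q).
  rewrite (_ : 2 * x < phi * p - q); last by lra.
  by move: big; lra.
rewrite pmulr_rgt0 // in h1.
have phi1 : 1 < phi by nra.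
have phi2 : phi < 2 by nra.
have f1 : phi * (p ^+ 2 + p * q + q ^+ 2) - 2 * p * (p + q) =
    (phi * q - p) * (q + (2 - phi) * p).
  have -> : (phi * q - p) * (q + (2 - phi) * p) = phi * q ^+ 2
    + (2 * phi - phi ^+ 2 - 1) * p * q - (2 - phi) * p ^+ 2 by ring.
  by rewrite phiE; ring.
have f2 : (phi * p - q) * (p ^+ 2 + p * q + q ^+ 2) - 2 * p * q * (p + q) =
    (p - phi * q) * (phi * p ^+ 2 + (2 * phi - 2) * p * q + (phi - 1) * q ^+ 2).
  have -> : (p - phi * q) * (phi * p ^+ 2 + (2 * phi - 2) * p * q + (phi - 1) * q ^+ 2)
    = phi * p ^+ 3 + (2 * phi - 2 - phi ^+ 2) * p ^+ 2 * q
      + (phi - 1 - 2 * phi ^+ 2 + 2 * phi) * p * q ^+ 2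
      - (phi ^+ 2 - phi) * q ^+ 3 by ring.
  by rewrite phiE; ring.
rewrite f1 pmulr_lgt0 in h1; last by rewrite addr_gt0 // mulr_gt0 //; lra.
rewrite f2 pmulr_lgt0 in h2; last first.
  have : 0 < (2 * phi - 2) * p * q by rewrite !mulr_gt0 //; lra.
  have : 0 < (phi - 1) * q ^+ 2 by rewrite mulr_gt0 ?exprn_gt0 //; lra.
  have : 0 < phi * p ^+ 2 by rewrite mulr_gt0 ?exprn_gt0.
  by lra.
lra.
Qed.

Lemma stuck_size I a x : valid I -> stuck d I a x -> (2 < size (placed a))%N.
Proof.
move=> [w0 _ _ _] st; case E: (placed a) => [|p [|q [|r s]]] //.
- have aE : a = [::] by case: (a) E.
  by case: (stuck_nonempty hd w0 (x := x)); rewrite -aE.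
- by case: (stuck1 hd w0 E st).
- by case: (stuck2 hd w0 E st).
Qed.

Lemma oblivious_small I : valid I -> (size (rings I) <= 3)%N -> oblivious d I.
Proof.
move=> vI s3 a ex; have [w0 _ _ _] := vI.
have [//|[s1 [x [s2 [a1 [sE [sub st]]]]]]] :=
  run_lex_or_stuck hd (valid_inventory vI) ex.
have := stuck_size vI st; have := size_subseq sub; move: s3.
rewrite sE size_cat /= addnS ltnS => h1 h2 h3.
have := leq_trans (leq_trans h3 h2) (leq_trans (leq_addr _ _) h1).
by rewrite ltnn.
Qed.

Lemma failing4_rho (phi : R) I : phi ^+ 2 = phi + 1 -> 0 < phi ->
  failing4 d I -> phi < rho I.
Proof.
move=> phiE phi0 [[vI [a [ex ne]]] s4]; have [w0 _ _ _] := vI.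
have inv := valid_inventory vI.
have [//|[s1 [x [s2 [a1 [sE [sub st]]]]]]] := run_lex_or_stuck hd inv ex.
have s3 := stuck_size vI st; have szs := size_subseq sub.
have s1E : size s1 = 3%N /\ size s2 = 0%N.
  move: s4; rewrite sE size_cat /= addnS ltnS => le.
  have h := leq_trans s3 szs; split; last first.
    apply/eqP; rewrite -leqn0 -(leq_add2l (size s1)) addn0.
    exact: leq_trans le h.
  by apply/eqP; rewrite eqn_leq h andbT (leq_trans (leq_addr _ _) le).
have paE : placed a1 = s1.
  by apply/eqP; rewrite -(size_subseq_leqif sub) eqn_leq szs s1E.1.
have [s1z /size0nil s2E] := s1E.
case: s1 s1z sE {sub szs s1E} paE => [|p [|q [|r [|? ?]]]] // _ sE paE.
have np := stuck3 hd w0 paE st.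
have := inv; rewrite sE s2E => -[/= /and5P[p0 q0 r0 x0 _] /and4P[qp rq xr _]].
have IE : I = Instance (width I) (pan I) [:: p; q; r; x].
  by move: sE; rewrite s2E /=; case: (I) => ? ? ? /= ->.
rewrite IE rho4 !lt_max.
by have [->|->] := golden_bound phiE phi0 x0 xr rq qp np; rewrite ?orbT.
Qed.

End Ratio.

(** * The crossing family *)

Section Crossing.
Variables (R : realType) (d : nat) (hd : (2 <= d)%N).

Lemma inf_of_approx (E : set R) (l : R) : (forall x, E x -> l < x) ->
  (forall e, 0 < e -> exists2 x, E x & x < l + e) -> inf E = l.
Proof.
move=> lb app; have hlb : has_lbound E by exists l => x /lb /ltW.
apply/eqP; rewrite eq_le; apply/andP; split; last first.
  apply: lb_le_inf; last by move=> x /lb /ltW.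
  by have [x Ex _] := app 1 ltr01; exists x.
apply/ler_addgt0Pr => e /app[x Ex xl].
by rewrite (le_trans _ (ltW xl)) // ge_inf.
Qed.

(** Let [N = 1 + t], and [u], [v] the square roots of [N (t - p) / p] and
    [N (t - q) / q]. The balls [1, p, q] pack as soon as [u + v >= t].
    Otherwise [p + q = t N / (N + u^2) + t N / (N + v^2)] is at least the value
    of this expression at [u + v] and [0], which decreases in [u + v]. *)
Lemma crossing_sum (t p q : R) : 0 < t < 1 -> 0 < p <= t -> 0 < q <= t ->
  ~ packs d (1 + t) [:: 1; p; q] ->
  t * (2 + 2 * t + t ^+ 2) < (p + q) * (1 + t + t ^+ 2).
Proof.
move=> /andP[t0 t1] /andP[p0 pt] /andP[q0 qt] np.
have pos y : 0 < y <= t -> 0 <= 1 * (1 + t) * y * (t - y).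
  by move=> /andP[y0 yt]; rewrite !mulr_ge0 ?subr_ge0 //; lra.
pose u := Num.sqrt (1 * (1 + t) * p * (t - p)) / p.
pose v := Num.sqrt (1 * (1 + t) * q * (t - q)) / q.
have u0 : 0 <= u by rewrite divr_ge0 ?sqrtr_ge0 // ltW.
have v0 : 0 <= v by rewrite divr_ge0 ?sqrtr_ge0 // ltW.
have uu : u ^+ 2 = (1 + t) * (t - p) / p.
  rewrite expr_div_n sqr_sqrtr; first by field; lra.
  by apply: pos; rewrite p0.
have vv : v ^+ 2 = (1 + t) * (t - q) / q.
  rewrite expr_div_n sqr_sqrtr; first by field; lra.
  by apply: pos; rewrite q0.
have uvt : u + v < t.
  rewrite ltNge; apply/negP => le; apply/np/packs3_planar; rewrite ?p0 ?q0 //.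
  have -> : Num.sqrt (1 * (1 + t) * p * (t - p)) = u * p by rewrite divfK // gt_eqF.
  have -> : Num.sqrt (1 * (1 + t) * q * (t - q)) = v * q by rewrite divfK // gt_eqF.
  have := ler_wpM2r (ltW (mulr_gt0 p0 q0)) le; lra.
pose N := 1 + t; have N1 : 1 < N by rewrite /N; lra.
have uN : 0 < N + u ^+ 2 by have := sqr_ge0 u; lra.
have vN : 0 < N + v ^+ 2 by have := sqr_ge0 v; lra.
have pE : p * (N + u ^+ 2) = t * N by rewrite uu /N; field; lra.
have qE : q * (N + v ^+ 2) = t * N by rewrite vv /N; field; lra.
have MM : 0 < (N + u ^+ 2) * (N + v ^+ 2) by rewrite mulr_gt0.
rewrite -(ltr_pM2r MM) -subr_gt0.
have -> : (p + q) * (1 + t + t ^+ 2) * ((N + u ^+ 2) * (N + v ^+ 2)) =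
    (1 + t + t ^+ 2) * (p * (N + u ^+ 2) * (N + v ^+ 2)
      + q * (N + v ^+ 2) * (N + u ^+ 2)) by ring.
rewrite pE qE.
have -> : (1 + t + t ^+ 2) * (t * N * (N + v ^+ 2) + t * N * (N + u ^+ 2)) -
    t * (2 + 2 * t + t ^+ 2) * ((N + u ^+ 2) * (N + v ^+ 2)) =
    t * (N ^+ 2 * (t ^+ 2 - (u + v) ^+ 2)
      + u * v * (2 * N ^+ 2 - 2 * N * (u * v) - t ^+ 2 * (u * v))).
  by rewrite /N; ring.
have uv0 : 0 <= u * v by rewrite mulr_ge0.
have uv1 : u * v <= 1 / 4 by have := sqr_ge0 (u - v); nra.
apply: mulr_gt0 => //; apply: ltr_pwDl.
  rewrite mulr_gt0 ?exprn_gt0 ?subr_gt0 //; first by lra.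
  by rewrite ltr_pXn2r ?nnegrE //; lra.
by apply: mulr_ge0 => //; nra.
Qed.

Lemma packs_crossing (N p q : R) : 0 < q -> q < p -> p < 1 ->
  packable d N [:: 1; p; q] <-> packs d N [:: 1; p; q].
Proof.
move=> q0 qp p1; apply: packableP => //=.
  by rewrite ltr01 q0 (lt_trans q0 qp).
by rewrite !inE negb_or !gt_eqF //; lra.
Qed.

Lemma tribonacci_bounds (T : R) : T ^+ 3 = T ^+ 2 + T + 1 ->
  18 / 10 < T < 19 / 10.
Proof.
move=> hT; apply/andP; split; rewrite ltNge; apply/negP => le.
  have : 0 <= (18 / 10 - T) * (T + 4 / 10) ^+ 2.
    by rewrite mulr_ge0 ?sqr_ge0 ?subr_ge0.
  lra.
have : 0 <= (T - 19 / 10) * (T + 45 / 100) ^+ 2.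
  by rewrite mulr_ge0 ?sqr_ge0 ?subr_ge0.
lra.
Qed.

Lemma crossing_rho_gt (T : R) (I : instance R) :
  T ^+ 3 = T ^+ 2 + T + 1 -> crossing_family d I -> T < rho I.
Proof.
move=> hT [t [p [q [w [[t1 tp pq q0] [w0 [pqw [np ->]]]]]]]].
have /andP[T1 T2] := tribonacci_bounds hT.
have p0 : 0 < p by lra.
have t0 : 0 < t by lra.
have sum : t * (2 + 2 * t + t ^+ 2) < (p + q) * (1 + t + t ^+ 2).
  apply: crossing_sum; rewrite ?t0 ?p0 ?q0 //=; try lra.
  by move=> pk; apply: np; apply/packs_crossing => //; lra.
have tT : t * T < 1.
  rewrite ltNge; apply/negP => tT.
  have h1 : 1 <= (t * T) ^+ 2 by rewrite exprn_ege1.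
  have h2 : 1 <= (t * T) ^+ 3 by rewrite exprn_ege1.
  have h3 : T ^+ 3 <= (t ^+ 3 + t ^+ 2 + t) * T ^+ 3.
    have -> : (t ^+ 3 + t ^+ 2 + t) * T ^+ 3 =
      (t * T) ^+ 3 + (t * T) ^+ 2 * T + (t * T) * T ^+ 2 by ring.
    have T0 : 0 <= T by lra.
    have := ler_wpM2r T0 h1.
    have := ler_wpM2r (sqr_ge0 T) tT; lra.
  have T3 : 0 < T ^+ 3 by rewrite exprn_gt0 //; lra.
  move: h3; rewrite -{1}[T ^+ 3]mul1r ler_pM2r // => h3.
  have : (p + q) * (1 + t + t ^+ 2) < 1 * (1 + t + t ^+ 2).
    by rewrite ltr_pM2r //; have := sqr_ge0 t; lra.
  lra.
rewrite rho4 !lt_max; apply/orP; right; apply/orP; left.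
rewrite ltr_pdivlMr //.
have D0 : 0 < 1 + t + t ^+ 2 by have := sqr_ge0 t; lra.
rewrite -(ltr_pM2r D0); apply: le_lt_trans sum.
have : t * ((t * T - 1) * ((T - 1) * t + (2 - T) * T)) <= 0.
  by rewrite pmulr_rle0 // nmulr_rle0 ?subr_lt0 // addr_ge0 // mulr_ge0 //; lra.
have -> : (t * T - 1) * ((T - 1) * t + (2 - T) * T) =
    T * ((T - 1) * t ^+ 2 + (T - 2) * t + (T - 2))
    + t * (- T ^+ 3 + T ^+ 2 + T + 1) by ring.
have z : - T ^+ 3 + T ^+ 2 + T + 1 = 0 by rewrite hT; ring.
rewrite z mulr0 addr0 mulrCA pmulr_rle0; last by lra.
lra.
Qed.

(** For [p = t] the best weights in [packs3_obstruction] for the balls [1, p, q]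
    degenerate to [1 : t : 0]. The weights [2 : 2 t : D] are close to them, and
    leave room for an [e] of the order of the square of [D], which is positive
    when [t] is below the reciprocal of the tribonacci constant. *)
Lemma crossing_unpackable (t e : R) (D := 1 - t - t ^+ 2 - t ^+ 3) :
  1 / 2 < t -> 0 < D -> 0 < e -> e <= D ^+ 2 / 100 -> 2 * e <= 2 * t - 1 ->
  ~ packs d (1 + t) [:: 1; t - e; 1 - t].
Proof.
move=> t2 D0 e0 eD et pk.
have t3 : 0 < t ^+ 3 by rewrite exprn_gt0 //; lra.
have t1 : t < 1 by rewrite /D in D0; have := sqr_ge0 t; lra.
have := @packs3_obstruction _ d 2 (2 * t) D (1 + t) 1 (t - e) (1 - t).
have a1 : 0 <= 2 * t by lra.
have a2 : 0 < t - e by lra.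
have a3 : 0 < 1 - t by lra.
have a4 : (1 : R) != t - e by rewrite gt_eqF //; lra.
have a5 : (1 : R) != 1 - t by rewrite gt_eqF //; lra.
have a6 : t - e != 1 - t by rewrite gt_eqF //; lra.
move=> /(_ (ler0n _ 2) a1 (ltW D0) ltr01 a2 a3 a4 a5 a6 pk).
rewrite -subr_ge0.
have D1 : D < 1 by rewrite /D; have := sqr_ge0 t; lra.
have -> : (2 + 2 * t + D) *
    (2 * (1 + t - 1) ^+ 2 + 2 * t * (1 + t - (t - e)) ^+ 2
     + D * (1 + t - (1 - t)) ^+ 2) -
    (2 * (2 * t) * (1 + (t - e)) ^+ 2 + 2 * D * (1 + (1 - t)) ^+ 2
     + 2 * t * D * (t - e + (1 - t)) ^+ 2) =
    16 * (t * (1 + t) * e) + 4 * (t * e) ^+ 2 - 8 * D ^+ 2 + 8 * (D * t * e)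
    + 4 * (t * D) ^+ 2 by rewrite /D; ring.
have b1 : t * (1 + t) * e <= 2 * e by rewrite ler_pM2r //; nra.
have DD : D ^+ 2 < 1 by rewrite expr_lt1 // ltW.
have te : t * e <= e by rewrite ger_pMl // ltW.
have b2 : (t * e) ^+ 2 <= e.
  have te0 : 0 <= t * e by rewrite mulr_ge0 // ltW //; lra.
  have := ler_pM te0 te0 te te; have e1 : e <= 1 by lra.
  have := ler_wpM2r (ltW e0) e1; lra.
have b3 : D * t * e <= e.
  by rewrite ger_pMl // mulr_ile1 // ltW //; lra.
have b4 : (t * D) ^+ 2 <= D ^+ 2.
  rewrite ler_pXn2r ?nnegrE ?mulr_ge0 ?ltW //; try lra.
  by rewrite gtr_pMl.
have DD0 : 0 < D ^+ 2 by rewrite exprn_gt0.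
lra.
Qed.

Lemma crossing_approx (T e : R) : T ^+ 3 = T ^+ 2 + T + 1 -> 0 < e ->
  exists2 I : instance R, crossing_family d I & rho I < T + e.
Proof.
move=> hT e0.
have /andP[T1 T2] := tribonacci_bounds hT.
pose k := Num.min e (1 / 20); have k0 : 0 < k by rewrite lt_min e0 /=; lra.
have ke : k <= e by rewrite ge_min lexx.
have k1 : k <= 1 / 20 by rewrite ge_min lexx orbT.
pose S := T + k; pose t := S^-1.
have S0 : 0 < S by rewrite /S; lra.
have tS : t * S = 1 by rewrite /t mulVf // gt_eqF.
have t0 : 0 < t by rewrite invr_gt0.
have t2 : 1 / 2 < t.
  rewrite ltNge; apply/negP => h; have := ler_wpM2r (ltW S0) h.
  by rewrite tS /S; lra.
pose D := 1 - t - t ^+ 2 - t ^+ 3.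
have S3 : S ^+ 2 + S + 1 < S ^+ 3.
  have -> : S ^+ 3 = T ^+ 3 + 3 * T ^+ 2 * k + 3 * T * k ^+ 2 + k ^+ 3.
    by rewrite /S; ring.
  have : 0 <= k ^+ 3 by rewrite exprn_ge0 // ltW.
  by rewrite hT /S; nra.
have D0 : 0 < D.
  have S30 : 0 < S ^+ 3 by rewrite exprn_gt0.
  rewrite -(pmulr_lgt0 _ S30).
  have -> : D * S ^+ 3 = S ^+ 3 - (t * S) * S ^+ 2 - (t * S) ^+ 2 * S
    - (t * S) ^+ 3 by rewrite /D; ring.
  by rewrite tS; lra.
pose f := Num.min (D ^+ 2 / 100) (t - 1 / 2) / 2.
have f0 : 0 < f by rewrite divr_gt0 // lt_min divr_gt0 ?exprn_gt0 //=; lra.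
have fD : f <= D ^+ 2 / 100.
  by rewrite /f ler_pdivrMr // ge_min; have := exprn_gt0 2 D0; lra.
have ft : 2 * f <= t - 1 / 2.
  by rewrite /f mulrC divfK // ge_min lexx orbT.
have t3 : 0 < t ^+ 3 by rewrite exprn_gt0.
have t1 : t < 1 by rewrite /D in D0; have := sqr_ge0 t; lra.
have tt : t + t ^+ 2 < 1 by rewrite /D in D0; lra.
exists (Instance f (1 + t) [:: 1; t; t - f; 1 - t]).
  exists t, (t - f), (1 - t), f; split; first by split; lra.
  split=> //; split; first by lra.
  split=> //; rewrite packs_crossing; [|lra..].
  by apply: crossing_unpackable => //; lra.
rewrite rho4; have SE : T + e >= 1 / t by rewrite div1r /t invrK /S; lra.
have t10 : 1 < 1 / t by rewrite ltr_pdivlMr // mul1r.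
apply: lt_le_trans SE.
rewrite !gt_max divr1; apply/and4P; split.
- by rewrite ltr_pdivlMr //; nra.
- by rewrite ltr_pM2r ?invr_gt0 //; lra.
- by apply: lt_trans t10; rewrite ltr_pdivrMr; lra.
- by rewrite divr_gt0.
Qed.

End Crossing.

(** * Following executions *)

Section Follow.
Variables (R : realType) (d : nat) (hd : (2 <= d)%N).
Implicit Types (I : instance R) (a : assignment R) (ch : placement_rule R).

Lemma continues_nil_inv ch I a a' : continues d ch I a [::] a' -> a' = a.
Proof. by move=> cs; inversion cs. Qed.

Lemma continues_admitted ch I a x s a' :
  (exists c, admits d (observe I a x) c) -> continues d ch I a (x :: s) a' ->
  exists c, [/\ admits d (observe I a x) c, ch (observe I a x) c &
    continues d ch I (rcons a (x, c)) s a'].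
Proof.
move=> [c ad] cs; inversion cs as [|? ? c' ? ? ad' cc' cs'|? ? ? ? na cs']; subst.
  by exists c'.
by case: (na c).
Qed.

Lemma continues_blocked ch I a x s a' :
  (forall c, ~ admits d (observe I a x) c) -> continues d ch I a (x :: s) a' ->
  continues d ch I a s a'.
Proof.
move=> na cs; inversion cs as [|? ? c' ? ? ad' cc' cs'|? ? ? ? na' cs']; subst => //.
by case: (na c').
Qed.

Lemma admits_fits I a x c (l : seq R) : fresh a x -> admits d (observe I a x) c ->
  (forall z, z \in l -> z = x \/ (z, c) \in a) -> packs d (capacity I c) l.
Proof.
move=> fr /(admitsP hd _ _ fr)[_ pk] sub; apply: packs_sub pk => z /sub.
by rewrite mem_rcons inE mem_occupants => -[->|->]; rewrite ?eqxx ?orbT.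
Qed.

Lemma admits_intro I a x c (l : seq R) : fresh a x ->
  c \in containers (placed a) -> x \in l ->
  (forall z, (z, c) \in a -> z \in l) -> packs d (capacity I c) l ->
  admits d (observe I a x) c.
Proof.
move=> fr cin xl sub pk; apply/admitsP => //; split=> //.
apply: packs_sub pk => z; rewrite mem_rcons inE mem_occupants.
by move=> /orP[/eqP ->|/sub].
Qed.

Lemma admits_hole I a x y : fresh a x -> admits d (observe I a x) (Some y) ->
  x <= y - width I.
Proof.
move=> fr ad; have [_ _ x0 _] := fr; apply/(@hole1 _ d) => //.
by apply: (admits_fits fr ad) => z; rewrite inE => /eqP ->; left.
Qed.

Lemma admits_hole_beside I a x y z : fresh a x -> (z, Some y) \in a ->
  admits d (observe I a x) (Some y) -> z + x <= y - width I.
Proof.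
move=> fr zy ad; have [_ /allP a0 x0 /allP xa] := fr.
have za : z \in placed a by apply/mapP; exists (z, Some y).
apply/(@hole2 _ d) => //; [exact: a0 | by rewrite gt_eqF // xa |].
apply: (admits_fits fr ad) => u; rewrite !inE => /orP[]/eqP ->; by [right|left].
Qed.

Lemma admits_container I a x c : admits d (observe I a x) c ->
  c = None \/ exists2 y, y \in placed a & c = Some y.
Proof.
by case=> /=; rewrite inE => /orP[/eqP|/mapP[y ya ->]]; [left|right; exists y].
Qed.

End Follow.

(** * Four-ring dilemmas *)

(** Four rings [p > q > r > x] for which the pan and the hole of [p] both
    admit [q], and neither has room for [q] together with [x]. The choice of
    [q] forces the rest of the execution: if [q] goes to the pan then [r] goes
    to the hole and [x] must join it there; if [q] goes to the hole then [r]
    goes to the pan and [x] must join it there. *)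
Section Dilemma.
Variables (R : realType) (d : nat) (hd : (2 <= d)%N) (w N p q r x : R).

Definition dilemma : Prop :=
  [/\ 0 < w, [/\ 0 < x, x < r, r < q & q < p],
      q <= p - w /\ p + q <= N,
      p - w < q + x /\ q - w < x & ~ packs d N [:: p; q; x]].

Hypothesis dil : dilemma.
Let I := Instance w N [:: p; q; r; x].

Let w0 : 0 < w. Proof. by case: dil. Qed.
Let x0 : 0 < x. Proof. by case: dil => _ []. Qed.
Let xr : x < r. Proof. by case: dil => _ []. Qed.
Let rq : r < q. Proof. by case: dil => _ []. Qed.
Let qp : q < p. Proof. by case: dil => _ []. Qed.
Let qpw : q <= p - w. Proof. by case: dil => _ _ []. Qed.
Let pqN : p + q <= N. Proof. by case: dil => _ _ []. Qed.
Let qx : p - w < q + x. Proof. by case: dil => _ _ _ []. Qed.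
Let xqw : q - w < x. Proof. by case: dil => _ _ _ []. Qed.
Let nopack : ~ packs d N [:: p; q; x]. Proof. by case: dil. Qed.
Let r0 : 0 < r. Proof. exact: lt_trans xr. Qed.
Let q0 : 0 < q. Proof. exact: lt_trans rq. Qed.
Let p0 : 0 < p. Proof. exact: lt_trans qp. Qed.

Let npq : p != q. Proof. by rewrite gt_eqF. Qed.
Let nqr : q != r. Proof. by rewrite gt_eqF. Qed.
Let pN : p <= N. Proof. by move: q0 pqN => *; lra. Qed.
Let rpw : r <= p - w. Proof. by move: rq qpw => *; lra. Qed.
Let prN : p + r <= N. Proof. by move: rq pqN => *; lra. Qed.
Let rqw : q - w < r. Proof. exact: lt_trans xr. Qed.
Let xrw : r - w < x. Proof. by move: rq xqw => *; lra. Qed.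
Let qr : p - w < q + r. Proof. by move: qx xr => *; lra. Qed.
Let pwN : p - w < N. Proof. by move: w0 q0 pqN => *; lra. Qed.

Let nopack_r : ~ packs d N [:: p; q; r].
Proof.
move=> pk; apply: nopack; apply: packs3_dom pk; rewrite ?lexx ?(ltW xr) //.
- by rewrite gt_eqF // (lt_trans xr) // (lt_trans rq).
- by rewrite gt_eqF // (lt_trans xr).
- by rewrite gt_eqF // (lt_trans rq).
Qed.

Lemma dilemma_valid : valid I.
Proof. split; rewrite //= ?p0 ?q0 ?r0 ?x0 ?qp ?rq ?xr //. by move: p0 q0 pqN => *; lra. Qed.

Let fresh1 : fresh [:: (p, None)] q.
Proof. by apply: inventory_fresh; split; rewrite /= ?p0 ?q0 ?qp. Qed.

Let fresh2 c : fresh [:: (p, None); (q, c)] r.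
Proof. by apply: inventory_fresh; split; rewrite /= ?p0 ?q0 ?r0 ?qp ?rq. Qed.

Let fresh3 c c' : fresh [:: (p, None); (q, c); (r, c')] x.
Proof.
by apply: inventory_fresh; split; rewrite /= ?p0 ?q0 ?r0 ?x0 ?qp ?rq ?xr.
Qed.

Lemma dilemma_start : admits d (observe I [::] p) None.
Proof.
have fr : fresh [::] p by apply: inventory_fresh; split; rewrite /= ?p0.
apply: (admits_intro hd (l := [:: p])) => //; first exact: mem_head.
exact/packs1.
Qed.

Lemma dilemma_first ch s a : continues d ch I [::] (p :: s) a ->
  continues d ch I [:: (p, None)] s a.
Proof.
move=> /(continues_admitted (ex_intro _ _ dilemma_start))[c [/admits_container[->|[]//] _]].
by [].
Qed.

Lemma dilemma_choices c :
  admits d (observe I [:: (p, None)] q) c <-> c = None \/ c = Some p.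
Proof.
split=> [/admits_container[->|[y + ->]]|[->|->]]; [by left| |..].
- by rewrite inE => /eqP ->; right.
- apply: (admits_intro hd (l := [:: p; q])) => //; rewrite ?inE ?eqxx ?orbT //.
    by move=> z; rewrite !inE xpair_eqE => /andP[->].
  by apply/(packs2 hd) => //; rewrite gt_eqF.
- apply: (admits_intro hd (l := [:: q])) => //; rewrite ?inE ?eqxx ?orbT //.
    by move=> z; rewrite !inE xpair_eqE andbF.
  exact/(@hole1 _ d).
Qed.

Lemma dilemma_second ch s a : continues d ch I [:: (p, None)] (q :: s) a ->
  exists c, [/\ c = None \/ c = Some p, ch (observe I [:: (p, None)] q) c &
    continues d ch I [:: (p, None); (q, c)] s a].
Proof.
have ex : exists c, admits d (observe I [:: (p, None)] q) c.
  by exists None; apply/dilemma_choices; left.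
move=> /(continues_admitted ex)[c [/dilemma_choices hc cc cs]].
by exists c.
Qed.

(** Beside [p] and [q] the pan has no room for [r] nor for [x], and the holes of
    [q] and [r] are too small: only the hole of [p] is left for both. *)
Lemma dilemma_pan ch a :
  continues d ch I [:: (p, None); (q, None)] [:: r; x] a ->
  placed a = if r + x <= p - w then [:: p; q; r; x] else [:: p; q; r].
Proof.
have ad : admits d (observe I [:: (p, None); (q, None)] r) (Some p).
  apply: (admits_intro hd (l := [:: r])) => //; rewrite ?inE ?eqxx ?orbT //.
    by move=> z; rewrite !inE !xpair_eqE !andbF.
  exact/(@hole1 _ d).
move=> /(continues_admitted (ex_intro _ _ ad))[c [adc _]].
have -> : c = Some p.
  have [cE|[y + cE]] := admits_container adc; rewrite cE in adc *.
    case: nopack_r; apply: (admits_fits hd (fresh2 _) adc) => z.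
    by rewrite !inE => /or3P[]/eqP ->; rewrite ?eqxx ?orbT; [right|right|left].
  rewrite !inE => /orP[]/eqP yE; first by rewrite yE.
  by have := admits_hole hd (fresh2 _) adc; rewrite yE /= leNgt rqw.
have hole_x c' : admits d (observe I [:: (p, None); (q, None); (r, Some p)] x) c' ->
    c' = Some p /\ r + x <= p - w.
  move=> adc'; have [cE|[y + cE]] := admits_container adc'; rewrite cE in adc' *.
    case: nopack; apply: (admits_fits hd (fresh3 _ _) adc') => z.
    by rewrite !inE => /or3P[]/eqP ->; rewrite ?eqxx ?orbT; [right|right|left].
  rewrite !inE => /or3P[]/eqP yE; rewrite yE in adc' *.
  - split=> //; apply: (admits_hole_beside hd (fresh3 _ _) _ adc').
    by rewrite !inE eqxx !orbT.
  - by have := admits_hole hd (fresh3 _ _) adc'; rewrite /= leNgt xqw.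
  - by have := admits_hole hd (fresh3 _ _) adc'; rewrite /= leNgt xrw.
rewrite /=; case: ifP => [fit|nofit].
  have adx : admits d (observe I [:: (p, None); (q, None); (r, Some p)] x) (Some p).
    apply: (admits_intro hd (l := [:: r; x])) => //; rewrite ?inE ?eqxx ?orbT //.
      by move=> z; rewrite !inE !xpair_eqE !andbF /= => /andP[->].
    by apply/(@hole2 _ d hd) => //; rewrite gt_eqF.
  move=> /(continues_admitted (ex_intro _ _ adx))[c' [_ _ /continues_nil_inv ->]].
  by [].
move=> /continues_blocked/continues_nil_inv -> // c' /hole_x[_].
by rewrite nofit.
Qed.

(** Beside [q] the hole of [p] has no room for [r] nor for [x], and the holes of
    [q] and [r] are too small: only the pan is left for both. *)
Lemma dilemma_hole ch a :
  continues d ch I [:: (p, None); (q, Some p)] [:: r; x] a ->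
  placed a = if `[< packs d N [:: p; r; x] >] then [:: p; q; r; x]
             else [:: p; q; r].
Proof.
have ad : admits d (observe I [:: (p, None); (q, Some p)] r) None.
  apply: (admits_intro hd (l := [:: p; r])) => //; rewrite ?inE ?eqxx ?orbT //.
    by move=> z; rewrite !inE !xpair_eqE !andbF orbF => /andP[->].
  by apply/(packs2 hd) => //=; rewrite gt_eqF // (lt_trans rq).
move=> /(continues_admitted (ex_intro _ _ ad))[c [adc _]].
have -> : c = None.
  have [//|[y + cE]] := admits_container adc; rewrite cE in adc *.
  rewrite !inE => /orP[]/eqP yE; rewrite yE in adc.
    have := admits_hole_beside hd (z := q) (fresh2 _) _ adc.
    by rewrite !inE eqxx orbT /= leNgt qr => /(_ isT).
  by have := admits_hole hd (fresh2 _) adc; rewrite /= leNgt rqw.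
have pan_x c' : admits d (observe I [:: (p, None); (q, Some p); (r, None)] x) c' ->
    c' = None /\ packs d N [:: p; r; x].
  move=> adc'; have [cE|[y + cE]] := admits_container adc'; rewrite cE in adc' *.
    split=> //; apply: (admits_fits hd (fresh3 _ _) adc') => z.
    by rewrite !inE => /or3P[]/eqP ->; rewrite ?eqxx ?orbT; [right|right|left].
  rewrite !inE => /or3P[]/eqP yE; rewrite yE in adc' *.
  - have := admits_hole_beside hd (z := q) (fresh3 _ _) _ adc'.
    by rewrite !inE eqxx orbT /= leNgt qx => /(_ isT).
  - by have := admits_hole hd (fresh3 _ _) adc'; rewrite /= leNgt xqw.
  - by have := admits_hole hd (fresh3 _ _) adc'; rewrite /= leNgt xrw.
rewrite /=; case: asboolP => [fit|nofit].
  have adx : admits d (observe I [:: (p, None); (q, Some p); (r, None)] x) None.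
    apply: (admits_intro hd (l := [:: p; r; x])) => //; rewrite ?inE ?eqxx ?orbT //.
    move=> z; rewrite !inE !xpair_eqE !andbF /= !andbT.
    by move=> /orP[]->; rewrite ?orbT.
  move=> /(continues_admitted (ex_intro _ _ adx))[c' [_ _ /continues_nil_inv ->]].
  by [].
by move=> /continues_blocked/continues_nil_inv -> // c' /pan_x[_].
Qed.

Lemma dilemma_lexmax : r + x <= p - w \/ packs d N [:: p; r; x] ->
  lexmax d I = rings I.
Proof.
have inv : inventory (rings I) by case: dilemma_valid.
move=> fits; rewrite -[LHS]/(lex d I (rings I)); apply: (lex_feasible hd _ inv) => //.
apply/(inventory_feasible hd) => //.
have [a cs] := continues_exists I
  (if `[< r + x <= p - w >] then [:: (p, None); (q, None)]
   else [:: (p, None); (q, Some p)]) [:: r; x] (@unrestricted_serial R d).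
have [ch0 rn] : exists ch, run d ch I (rings I) a.
  exists (@unrestricted R); apply/run_continues.
  apply: (continues_place dilemma_start) => //=.
  move: cs; case: ifP => _ cs.
    by apply: (continues_place ((dilemma_choices None).2 _)) => //; left.
  by apply: (continues_place ((dilemma_choices (Some p)).2 _)) => //; right.
suff paE : placed a = rings I.
  by exists (parent a); rewrite -{1}paE; have [] := run_placement hd inv rn.
move: cs; case: asboolP => [le /dilemma_pan ->|nle /dilemma_hole ->].
  by rewrite le.
by case: asboolP => // npk; case: fits.
Qed.

Lemma dilemma_execution ch a : execution d ch I a ->
  exists c, [/\ c = None \/ c = Some p, ch (observe I [:: (p, None)] q) c &
    placed a = if (if c is None then r + x <= p - w
                   else `[< packs d N [:: p; r; x] >])
               then [:: p; q; r; x] else [:: p; q; r]].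
Proof.
move=> /run_continues/dilemma_first/dilemma_second[c [[->|->] cc cs]].
  by exists None; rewrite (dilemma_pan cs); split=> //; left.
by exists (Some p); rewrite (dilemma_hole cs); split=> //; right.
Qed.

Lemma dilemma_best_fit c :
  best_fit d (observe I [:: (p, None)] q) c -> c = None \/ c = Some p ->
  c = Some p.
Proof.
move=> /[swap] -[->|->] // best.
have := best (Some p) ((dilemma_choices _).2 (or_intror erefl)).
by rewrite /= /I /= le_max !leNgt pwN (lt_le_trans p0 pN).
Qed.

Lemma dilemma_worst_fit c :
  worst_fit d (observe I [:: (p, None)] q) c -> c = None \/ c = Some p ->
  c = None.
Proof.
move=> /[swap] -[->|->] // worst.
have := worst None ((dilemma_choices _).2 (or_introl erefl)).
by rewrite /= /I /= le_max !leNgt pwN (lt_le_trans p0 pN).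
Qed.

End Dilemma.

(** * Randomized rules *)

Section Random.
Variables (R : realType) (d : nat) (mu : state R -> container R -> R).
Hypothesis rnd : randomized_rule d mu.
Variable I : instance R.

Lemma fail_prob_ge0 s a : 0 <= fail_prob_from d mu I s a.
Proof.
elim: s a => [|x s IH] a /=; first exact: ler0n.
case: asboolP => // ex; have [mu0 _ _] := rnd ex.
by apply: sumr_ge0 => c _; apply: mulr_ge0.
Qed.

Lemma fail_prob_branch x s a c : admits d (observe I a x) c ->
  mu (observe I a x) c * fail_prob_from d mu I s (rcons a (x, c)) <=
  fail_prob_from d mu I (x :: s) a.
Proof.
move=> ad /=; have ex : exists c, admits d (observe I a x) c by exists c.
rewrite asboolT //; have [mu0 _ _] := rnd ex.
have cin : c \in undup (st_containers (observe I a x)).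
  by rewrite mem_undup; exact: ad.1.
rewrite (bigD1_seq _ cin (undup_uniq _)) /=.
by rewrite lerDl; apply: sumr_ge0 => c' _; rewrite mulr_ge0 // fail_prob_ge0.
Qed.

Lemma fail_prob_certain s a :
  (forall a', continues d (@unrestricted R) I a s a' -> placed a' <> lexmax d I) ->
  fail_prob_from d mu I s a = 1.
Proof.
elim: s a => [|x s IH] a bad /=.
  by have /eqP -> := bad a (continues_nil _ _ _ _).
case: asboolP => [ex|nex]; last first.
  apply: IH => a' cs; apply: bad; apply: continues_skip cs => c ad.
  by apply: nex; exists c.
have [_ muN <-] := rnd ex; apply: eq_bigr => c _.
have [ad|/muN ->] := pselect (admits d (observe I a x) c); last by rewrite mul0r.
rewrite IH ?mulr1 // => a' cs; apply: bad.
exact: continues_place cs.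
Qed.

End Random.

Section Outcomes.
Variables (R : realType) (d : nat) (hd : (2 <= d)%N).

(** The balls [a] and [b] span a diameter, so that [a] times the center of [a]
    and [b] times that of [b] cancel out. Accordingly the terms in [k^2] of
    [packs3_obstruction] vanish for the weights [a k, b k, 1], and a large [k]
    isolates the condition on [e]. *)
Lemma packs3_diameter_le (a b e : R) : 0 < e -> e < b -> b < a ->
  packs d (a + b) [:: a; b; e] ->
  e * (a ^+ 2 + a * b + b ^+ 2) <= a * b * (a + b).
Proof.
move=> e0 eb ba pk; rewrite leNgt; apply/negP => big.
have b0 : 0 < b by lra.
have a0 : 0 < a by lra.
pose C := e * (a ^+ 2 + a * b + b ^+ 2) - a * b * (a + b).
have C0 : 0 < C by rewrite subr_gt0.
pose k := (a + b - e) ^+ 2 / (2 * C).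
have kC : k * (2 * C) = (a + b - e) ^+ 2 by rewrite divfK // gt_eqF // mulr_gt0.
have S0 : 0 < (a + b - e) ^+ 2 by rewrite exprn_gt0 //; lra.
have k0 : 0 < k by rewrite divr_gt0 // mulr_gt0.
have h1 : 0 <= a * k by rewrite mulr_ge0 // ltW.
have h2 : 0 <= b * k by rewrite mulr_ge0 // ltW.
have n1 : a != b by rewrite gt_eqF.
have n2 : a != e by rewrite gt_eqF //; lra.
have n3 : b != e by rewrite gt_eqF.
have := packs3_obstruction h1 h2 ler01 a0 b0 e0 n1 n2 n3 pk.
rewrite -subr_ge0 [X in 0 <= X](_ : _ = (a + b - e) ^+ 2 - 2 * (k * (2 * C)));
  last by rewrite /C; ring.
rewrite kC; lra.
Qed.

Lemma dilemma_intro (w N p q r x : R) : 0 < w ->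
  [/\ 0 < x, x < r, r < q & q < p] -> q <= p - w -> N = p + q ->
  p - w < q + x -> q - w < x ->
  p * q * (p + q) < x * (p ^+ 2 + p * q + q ^+ 2) ->
  dilemma d w N p q r x.
Proof.
move=> w0 [x0 xr rq qp] qpw -> qx xqw big; split=> // pk.
by move: big; rewrite ltNge packs3_diameter_le //; lra.
Qed.

Variables (w N p q r x : R).
Let I := Instance w N [:: p; q; r; x].
Hypothesis dil : dilemma d w N p q r x.
Hypothesis fits : r + x <= p - w \/ packs d N [:: p; r; x].

Let st := observe I [:: (p, None)] q.

Lemma dilemma_notin : x \notin [:: p; q; r].
Proof.
have [_ [_ xr rq qp] _ _ _] := dil.
by rewrite !inE !negb_or !lt_eqF // (lt_trans xr) // (lt_trans rq).
Qed.

(** By [dilemma_pan] and [dilemma_hole], these are the containers for [q] after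
    which all four rings get placed. *)
Definition good_choice (c : container R) : Prop :=
  if c is None then r + x <= p - w else packs d N [:: p; r; x].

Lemma dilemma_good ch a :
  (forall c, ch st c -> c = None \/ c = Some p -> good_choice c) ->
  execution d ch I a -> placed a = rings I.
Proof.
move=> good /(dilemma_execution hd dil)[c [cpq /good/(_ cpq)]].
by move: cpq => [->|->] /=; [move=> -> | move=> pk; rewrite asboolT].
Qed.

Lemma dilemma_bad ch a :
  (forall c, ch st c -> c = None \/ c = Some p -> ~ good_choice c) ->
  execution d ch I a -> placed a = [:: p; q; r].
Proof.
move=> bad /(dilemma_execution hd dil)[c [cpq /bad/(_ cpq)]].
by move: cpq => [->|->] /= nfit; [move/negP/negbTE: nfit => -> | rewrite asboolF].
Qed.

Lemma dilemma_succeeds ch : serial d ch ->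
  (forall c, ch st c -> c = None \/ c = Some p -> good_choice c) ->
  succeeds d ch I.
Proof.
move=> ser good; split; last first.
  by move=> a /(dilemma_good good) ->; rewrite (dilemma_lexmax hd dil).
have [a cs] := continues_exists I [::] (rings I) ser.
by exists a; apply/run_continues.
Qed.

Lemma dilemma_fails ch : serial d ch ->
  (forall c, ch st c -> c = None \/ c = Some p -> ~ good_choice c) ->
  fails d ch I.
Proof.
move=> ser bad; split; last first.
  by move=> a /(dilemma_bad bad) ->; rewrite (dilemma_lexmax hd dil).
have [a cs] := continues_exists I [::] (rings I) ser.
by exists a; apply/run_continues.
Qed.

Lemma dilemma_observed : exists2 a, run d (@unrestricted R) I [:: p] a &
  forall a, run d (@unrestricted R) I [:: p] a -> observe I a q = st.
Proof.
have [a cs] := continues_exists I [::] [:: p] (@unrestricted_serial R d).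
exists a; first exact/run_continues.
by move=> a' /run_continues/(dilemma_first hd dil)/continues_nil_inv ->.
Qed.

Lemma dilemma_fail_prob mu c : randomized_rule d mu -> ~ good_choice c ->
  c = None \/ c = Some p -> mu st c <= fail_prob d mu I.
Proof.
move=> rnd bad cpq.
have start := dilemma_start hd dil.
have mu1 : mu (observe I [::] p) None = 1.
  by have [_ _] := rnd _ (ex_intro _ _ start); rewrite /= big_seq1.
apply: le_trans (fail_prob_branch rnd [:: q; r; x] start).
rewrite mu1 mul1r /=.
have adc : admits d (observe I [:: (p, None)] q) c.
  exact/(dilemma_choices hd dil).
apply: le_trans (fail_prob_branch rnd [:: r; x] adc).
rewrite fail_prob_certain ?mulr1 // => a' cs.
rewrite (dilemma_lexmax hd dil fits) /= in cs *.
move: bad cs; case: cpq => -> /= bad cs.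
  by rewrite (dilemma_pan hd dil cs); move/negP/negbTE: bad => ->.
by rewrite (dilemma_hole hd dil cs) asboolF.
Qed.

Lemma dilemma_total mu : randomized_rule d mu ->
  mu st None + mu st (Some p) = 1.
Proof.
move=> rnd; have adc : admits d st None by apply/(dilemma_choices hd dil); left.
have [_ _ <-] := rnd _ (ex_intro _ _ adc).
by rewrite /= !big_cons big_nil addr0.
Qed.

Lemma dilemma_best_choice c : best_fit d st c -> c = None \/ c = Some p ->
  c = Some p.
Proof. exact: dilemma_best_fit. Qed.

Lemma dilemma_worst_choice c : worst_fit d st c -> c = None \/ c = Some p ->
  c = None.
Proof. exact: dilemma_worst_fit. Qed.

End Outcomes.

(** * Inventories approaching the golden ratio *)

Section Golden.
Variables (R : realType) (d : nat) (hd : (2 <= d)%N).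

(** At [t = 1/phi] the extremal configuration of [golden_bound] has radii
    [1, t, 1/2, 1/2]; the two smallest are enlarged slightly, which makes them
    too large for the hole of [1] together and for the gap beside [1] and [t],
    while the two of them still fit beside [1]. *)
Lemma golden_approx (phi e : R) : phi ^+ 2 = phi + 1 -> 0 < phi -> 0 < e ->
  exists2 I : instance R, failing4 d I & rho I < phi + e.
Proof.
move=> phiE phi0 e0.
have f1 : 16 / 10 < phi by nra.
have f2 : phi < 165 / 100 by nra.
pose t := phi - 1; have tt : t ^+ 2 = 1 - t by rewrite /t sqrrB phiE; ring.
pose f := Num.min (e / 6) (1 / 100).
have f0 : 0 < f by rewrite lt_min divr_gt0 //=; lra.
have fe : f <= e / 6 by rewrite ge_min lexx.
have f3 : f <= 1 / 100 by rewrite ge_min lexx orbT.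
have tphi : t * phi = 1 by rewrite /t; lra.
have t0 : 6 / 10 < t by rewrite /t; lra.
have dil : dilemma d (1 - t) (1 + t) 1 t (1 / 2 + 2 * f) (1 / 2 + f).
  apply: dilemma_intro; rewrite /t; try lra.
    by split; lra.
  rewrite -/t.
  by rewrite expr1n tt /t; lra.
have pk : packs d (1 + t) [:: 1; 1 / 2 + 2 * f; 1 / 2 + f].
  have half y : 0 < y <= 52 / 100 ->
      t / 2 * y <= Num.sqrt (1 * (1 + t) * y * (t - y)).
    move=> /andP[y0 y1].
    have -> : t / 2 * y = Num.sqrt ((t / 2 * y) ^+ 2).
      by rewrite sqrtr_sqr ger0_norm // !mulr_ge0 // ?ltW //; rewrite /t; lra.
    apply: ler_wsqrtr.
    have -> : (t / 2 * y) ^+ 2 = y * (t ^+ 2 / 4 * y) by field.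
    have -> : 1 * (1 + t) * y * (t - y) = y * (t + t ^+ 2 - (1 + t) * y) by ring.
    by rewrite ler_pM2l // tt /t; nra.
  apply: packs3_planar => //; rewrite /t; try lra.
  rewrite -/t.
  have h1 := half (1 / 2 + 2 * f); have h2 := half (1 / 2 + f).
  have g1 : 0 < 1 / 2 + 2 * f <= 52 / 100 by lra.
  have g2 : 0 < 1 / 2 + f <= 52 / 100 by lra.
  have {}h1 := ler_wpM2r (ltW (andP g2).1) (h1 g1).
  have {}h2 := ler_wpM2r (ltW (andP g1).1) (h2 g2).
  lra.
exists (Instance (1 - t) (1 + t) [:: 1; t; 1 / 2 + 2 * f; 1 / 2 + f]).
  split=> //; split; first exact: dilemma_valid dil.
  have [[a ex] bad] : fails d (worst_fit d)
      (Instance (1 - t) (1 + t) [:: 1; t; 1 / 2 + 2 * f; 1 / 2 + f]).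
    apply: (dilemma_fails hd dil (or_intror pk)).
      exact: worst_fit_serial.
    move=> c /(dilemma_worst_choice hd dil) h /h -> /=.
    by apply/negP; rewrite -ltNge /t; lra.
  exists a; split; last exact: bad.
  exact/run_continues/continues_weaken/run_continues/ex.
rewrite rho4 !gt_max; apply/and4P; split.
- by rewrite divr1 /t; lra.
- rewrite ltr_pdivrMr; last by rewrite /t; lra.
  have et : e * (6 / 10) < e * t by rewrite ltr_pM2l.
  by move: tphi et fe; lra.
- by rewrite ltr_pdivrMr; [nra | lra].
- lra.
Qed.

End Golden.

(** * The instances of the statement *)

Section Instances.
Variables (R : realType) (d : nat) (hd : (2 <= d)%N).

Lemma golden_ratio_sqr (phi := (1 + Num.sqrt 5) / 2 : R) :
  phi ^+ 2 = phi + 1.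
Proof. by rewrite /phi expr_div_n sqrrD sqr_sqrtr ?ler0n //; field. Qed.

Lemma dilemma_I0 : dilemma d (3 / 10 : R) 15 10 5 (49 / 10) (48 / 10).
Proof. by apply: dilemma_intro; [lra | split; lra | lra..]. Qed.

Lemma dilemma_I1 :
  dilemma d (505 / 1000 : R) 15 10 5 (499 / 100) (450 / 100).
Proof. by apply: dilemma_intro; [lra | split; lra | lra..]. Qed.

Lemma dilemma_I2 :
  dilemma d (505 / 1000 : R) 15 10 5 (476 / 100) (474 / 100).
Proof. by apply: dilemma_intro; [lra | split; lra | lra..]. Qed.

Lemma unpackable_I0 : ~ packs d (15 : R) [:: 10; 49 / 10; 48 / 10].
Proof.
move=> pk.
(* the weights 3, 1, 1, and 7, 3, 1 below, approximate the ones for which the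
   combination of the three centers would vanish in a nearly valid packing *)
have h3 : (0 : R) <= 3 by lra.
have g1 : (0 : R) < 10 by lra.
have g2 : (0 : R) < 49 / 10 by lra.
have g3 : (0 : R) < 48 / 10 by lra.
have n1 : (10 : R) != 49 / 10 by apply/eqP; lra.
have n2 : (10 : R) != 48 / 10 by apply/eqP; lra.
have n3 : (49 / 10 : R) != 48 / 10 by apply/eqP; lra.
by have := packs3_obstruction h3 ler01 ler01 g1 g2 g3 n1 n2 n3 pk; lra.
Qed.

Lemma unpackable_I1 : ~ packs d (15 : R) [:: 10; 499 / 100; 450 / 100].
Proof.
move=> pk.
have h7 : (0 : R) <= 7 by lra.
have h3 : (0 : R) <= 3 by lra.
have g1 : (0 : R) < 10 by lra.
have g2 : (0 : R) < 499 / 100 by lra.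
have g3 : (0 : R) < 450 / 100 by lra.
have n1 : (10 : R) != 499 / 100 by apply/eqP; lra.
have n2 : (10 : R) != 450 / 100 by apply/eqP; lra.
have n3 : (499 / 100 : R) != 450 / 100 by apply/eqP; lra.
by have := packs3_obstruction h7 h3 ler01 g1 g2 g3 n1 n2 n3 pk; lra.
Qed.

Lemma packable_I2 : packs d (15 : R) [:: 10; 476 / 100; 474 / 100].
Proof.
have -> : (15 : R) = 10 + 5 by lra.
have root (y : R) : 169 <= y -> 13 <= Num.sqrt y.
  move=> hy; rewrite -[leLHS]ger0_norm // -sqrtr_sqr; apply: ler_wsqrtr; lra.
apply: packs3_planar; [by []|lra..|].
(* both roots exceed 13, and [13 * (4.74 + 4.76) > 5 * 4.76 * 4.74] *)
have := root (10 * (10 + 5) * (476 / 100) * (5 - 476 / 100)).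
have := root (10 * (10 + 5) * (474 / 100) * (5 - 474 / 100)).
set P := Num.sqrt _; set Q := Num.sqrt _ => h1 h2.
have {}h1 : 13 <= P by apply: h1; lra.
have {}h2 : 13 <= Q by apply: h2; lra.
lra.
Qed.

End Instances.

Theorem corollary33 (R : realType) (d : nat) (hd : (2 <= d)%N)
    (T : R) (hT : T ^+ 3 = T ^+ 2 + T + 1) :
  let phi : R := (1 + Num.sqrt 5) / 2 in
  let I0 : instance R :=
    Instance (3 / 10) 15 [:: 10; 5; 49 / 10; 48 / 10] in
  let I1 : instance R :=
    Instance (505 / 1000) 15 [:: 10; 5; 499 / 100; 450 / 100] in
  let I2 : instance R :=
    Instance (505 / 1000) 15 [:: 10; 5; 476 / 100; 474 / 100] in
  (* (1) *)
  ((forall I : instance R, valid I -> (size (rings I) <= 3)%N ->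
      oblivious d I) /\
   (exists I : instance R,
      valid I /\ size (rings I) = 4%N /\ ~ oblivious d I) /\
   lexmax d I0 = rings I0 /\
   always_places d (@best_fit R d) I0 (fun S => 48 / 10 \notin S) /\
   always_places d (@worst_fit R d) I0 (fun S => S = rings I0)) /\
  (* (2) *)
  (fails d (@best_fit R d) I1 /\ succeeds d (@worst_fit R d) I1 /\
   fails d (@worst_fit R d) I2 /\ succeeds d (@best_fit R d) I2 /\
   (exists st : state R,
      (exists a, run d (@unrestricted R) I1 [:: 10] a) /\
      (exists a, run d (@unrestricted R) I2 [:: 10] a) /\
      (forall a, run d (@unrestricted R) I1 [:: 10] a ->
         observe I1 a 5 = st) /\
      (forall a, run d (@unrestricted R) I2 [:: 10] a ->
         observe I2 a 5 = st)) /\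
   (forall f : state R -> container R, deterministic_rule d f ->
      exists I : instance R, (I = I1 \/ I = I2) /\ fails d (follow f) I) /\
   (forall mu : state R -> container R -> R, randomized_rule d mu ->
      exists I : instance R, (I = I1 \/ I = I2) /\
        1 / 2 <= fail_prob d mu I)) /\
  (* (3) *)
  (inf (@rho R @` crossing_family d) = T /\
   ~ (@rho R @` crossing_family d) T) /\
  (* (4) *)
  (1 <= tau R d /\ tau R d <= phi /\ tau4 R d = phi /\
   ~ (@rho R @` failing4 d) phi).
Proof.
move=> phi I0 I1 I2.
have dil0 := dilemma_I0 R d; have dil1 := dilemma_I1 R d.
have dil2 := dilemma_I2 R d.
have pan0 : good_choice d (3 / 10) 15 10 (49 / 10) (48 / 10) (None : container R).
  by rewrite /=; lra.
have hole0 : ~ good_choice d (3 / 10) 15 10 (49 / 10) (48 / 10) (Some 10 : container R).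
  exact: unpackable_I0.
have pan1 : good_choice d (505 / 1000) 15 10 (499 / 100) (450 / 100) (None : container R).
  by rewrite /=; lra.
have hole1 : ~ good_choice d (505 / 1000) 15 10 (499 / 100) (450 / 100) (Some 10 : container R).
  exact: unpackable_I1.
have pan2 : ~ good_choice d (505 / 1000) 15 10 (476 / 100) (474 / 100) (None : container R).
  by apply/negP; rewrite -ltNge; lra.
have hole2 : good_choice d (505 / 1000) 15 10 (476 / 100) (474 / 100) (Some 10 : container R).
  exact: packable_I2.
have fits0 : (49 / 10 : R) + 48 / 10 <= 10 - 3 / 10 \/ packs d 15 [:: 10; 49 / 10; 48 / 10 : R] by left; exact: pan0.
have fits1 : (499 / 100 : R) + 450 / 100 <= 10 - 505 / 1000 \/
    packs d 15 [:: 10; 499 / 100; 450 / 100 : R] by left; exact: pan1.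
have fits2 : (476 / 100 : R) + 474 / 100 <= 10 - 505 / 1000 \/
    packs d 15 [:: 10; 476 / 100; 474 / 100 : R] by right; exact: hole2.
have lex0 : lexmax d I0 = rings I0 := dilemma_lexmax hd dil0 fits0.
have [[best0 best0E] best0_bad] : fails d (best_fit d) I0.
  apply: (dilemma_fails hd dil0 fits0); first exact: best_fit_serial.
  by move=> c /(dilemma_best_choice hd dil0) h /h ->.
have [[worst0 worst0E] worst0_good] : succeeds d (worst_fit d) I0.
  apply: (dilemma_succeeds hd dil0 fits0); first exact: worst_fit_serial.
  by move=> c /(dilemma_worst_choice hd dil0) h /h ->.
have phiE : phi ^+ 2 = phi + 1 := golden_ratio_sqr R.
have phi0 : 0 < phi by rewrite divr_gt0 // ltr_pwDl // sqrtr_ge0.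
have tau4E : tau4 R d = phi.
  apply: inf_of_approx => [_ [I fI <-]|e e0]; first exact: failing4_rho fI.
  have [I fI le] := golden_approx hd phiE phi0 e0.
  by exists (rho I) => //; exists I.
split.
  split; first by move=> I vI s3; exact: oblivious_small.
  split.
    exists I0; split; first exact: dilemma_valid dil0.
    split=> // obl; apply: (best0_bad best0 best0E); apply: obl.
    exact/run_continues/continues_weaken/run_continues/best0E.
  split=> //; split; last first.
    split; first by exists worst0.
    by move=> a ex; rewrite (worst0_good a ex) lex0.
  split; first by exists best0.
  move=> a ex; rewrite (dilemma_bad hd dil0 _ ex); last first.
    by move=> c /(dilemma_best_choice hd dil0) h /h ->.
  exact: dilemma_notin dil0.
split.
  split.
    apply: (dilemma_fails hd dil1 fits1); first exact: best_fit_serial.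
    by move=> c /(dilemma_best_choice hd dil1) h /h ->.
  split.
    apply: (dilemma_succeeds hd dil1 fits1); first exact: worst_fit_serial.
    by move=> c /(dilemma_worst_choice hd dil1) h /h ->.
  split.
    apply: (dilemma_fails hd dil2 fits2); first exact: worst_fit_serial.
    by move=> c /(dilemma_worst_choice hd dil2) h /h ->.
  split.
    apply: (dilemma_succeeds hd dil2 fits2); first exact: best_fit_serial.
    by move=> c /(dilemma_best_choice hd dil2) h /h ->.
  split.
    exists (observe I1 [:: (10, None)] 5).
    have [a1 r1 o1] := dilemma_observed hd dil1.
    have [a2 r2 o2] := dilemma_observed hd dil2.
    by split; [exists a1 | split; [exists a2 | split]].
  split.
    move=> f df; pose st := observe I1 [:: (10, None)] 5.
    case E : (f st) => [y|].
      exists I1; split; first by left.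
      apply: (dilemma_fails hd dil1 fits1); first exact: follow_serial.
      by move=> c; rewrite /follow -/st E => -> [//|->].
    exists I2; split; first by right.
    apply: (dilemma_fails hd dil2 fits2); first exact: follow_serial.
    by move=> c; rewrite /follow -[observe _ _ _]/st E => -> [_|//].
  move=> mu rnd; have tot := dilemma_total hd dil1 rnd.
  have b1 := dilemma_fail_prob hd dil1 fits1 rnd hole1 (or_intror erefl).
  have b2 := dilemma_fail_prob hd dil2 fits2 rnd pan2 (or_introl erefl).
  set m1 := mu _ _ in b1 tot; set m2 := mu _ _ in b2 tot.
  have [le|lt] := leP (1 / 2) m1.
    by exists I1; split; [left | exact: le_trans b1].
  exists I2; split; [by right | apply: le_trans b2].
  by move: tot lt; clear; lra.
split.
  split; last by move=> [I /(crossing_rho_gt hd hT) + rE]; rewrite rE ltxx.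
  apply: inf_of_approx => [_ [I fI <-]|e e0]; first exact: (crossing_rho_gt hd hT).
  have [I fI le] := crossing_approx hd hT e0.
  by exists (rho I) => //; exists I.
have [J fJ _] := golden_approx hd phiE phi0 (@ltr01 R).
have lb x : (@rho R @` failing d) x -> 1 <= x.
  by move=> [I fI <-]; apply/ltW/(failing_rho_gt1 hd fI).
split; first by apply: lb_le_inf => //; exists (rho J); exists J => //; exact: fJ.1.
split.
  rewrite -tau4E; apply: lb_le_inf; first by exists (rho J); exists J.
  move=> _ [I fI <-]; apply: ge_inf; first by exists 1 => x /lb.
  by exists I => //; exact: fI.1.
split=> // -[I fI E]; have := failing4_rho hd phiE phi0 fI.
by rewrite E ltxx.
Qed.
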